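(* Let $Z$ be a set, $A=\mathbf{k}\mathcal{M}(Z)/I_A$ a unital $\mathbf{k}$-algebra (with $I_A$ an ideal of $\mathbf{k}\mathcal{M}(Z)$), and $\phi$ an OPI of Rota–Baxter type. Then $$\mathcal{F}^{\phi\text{-}\mathrm{Alg}}_{\mathrm{uAlg}}(A)=\mathbf{k}\mathfrak{M}(Z)/\langle S_\phi(Z)\cup I_A\rangle_{\mathrm{uOpAlg}}.$$ Moreover, assume that $I_A$ has a GS basis $G$ with respect to the degree lexicographical order $\le_{\mathrm{dlex}}$. Then $S_\phi(Z)\cup G$ is an operated GS basis of $\langle S_\phi(Z)\cup I_A\rangle_{\mathrm{uOpAlg}}$ in $\mathbf{k}\mathfrak{M}(Z)$ with respect to $\le_{\mathrm{db}}$.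
   Context: $\mathbf{k}$ is a field; $\mathcal{M}(Z)$ is the free monoid on $Z$. A unital operated algebra is a unital $\mathbf{k}$-algebra with a $\mathbf{k}$-linear operator; an operated ideal is a (two-sided) ideal closed under the operator; $\langle S\rangle_{\mathrm{uOpAlg}}$ is the operated ideal generated by $S$. $\mathfrak{M}(Z)$ is the free operated monoid on $Z$ (bracketed words): $\mathfrak{M}(Z)=\bigcup_n\mathfrak{M}_n$ with $\mathfrak{M}_0=\mathcal{M}(Z)$, $\mathfrak{M}_{n+1}=\mathcal{M}(Z\sqcup\lfloor\mathfrak{M}_n\rfloor)$, operator $u\mapsto\lfloor u\rfloor$. $\mathbf{k}\mathfrak{M}(Z)$ is the free unital operated algebra on $Z$. Each $u\ne1$ in $\mathfrak{M}(Z)$ is uniquely a product $u_1\cdots u_n$ with $u_i\in Z\cup\lfloor\mathfrak{M}(Z)\rfloor$; its breadth is $|u|=n$, and $|1|=0$. For $\star\notin Z$, $\mathfrak{M}^\star(Z)$ is the set of elements of $\mathfrak{M}(Z\cup\{\star\})$ in which $\star$ occurs exactly once; $q|_u$ is obtained from $q$ by replacing $\star$ by $u$, extended linearly in $u$. $u$ is a subword of $w$ if $w=q|_u$ for some $q\in\mathfrak{M}^\star(Z)$. A monomial order on $\mathfrak{M}(Z)$ is a well-order with $u<v\Rightarrow q|_u<q|_v$ for all $q\in\mathfrak{M}^\star(Z)$. The leading monomial $\bar f$ of $f\notin\mathbf{k}$ is its largest monomial; $\bar f=1$ for $f\in\mathbf{k}$. For monic $f,g$: if $w=\bar fu=v\bar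 g$ with $\max\{|\bar f|,|\bar g|\}<|w|<|\bar f|+|\bar g|$, then $fu-vg$ is an intersection composition with respect to $w$; if $w=\bar f=q|_{\bar g}$, then $f-q|_g$ is an inclusion composition with respect to $w$. An element is trivial modulo $(\mathcal{G},w)$ if it equals a finite sum $\sum_ic_iq_i|_{s_i}$ with $c_i\in\mathbf{k}$, $q_i\in\mathfrak{M}^\star(Z)$, $s_i\in\mathcal{G}$, $q_i|_{\bar s_i}<w$. $\mathcal{G}\subseteq\mathbf{k}\mathfrak{M}(Z)$ is an operated GS basis in $\mathbf{k}\mathfrak{M}(Z)$ if all compositions of (monicized) elements of $\mathcal{G}$ are trivial modulo $(\mathcal{G},w)$; it is an operated GS basis of an operated ideal if it moreover generates that operated ideal. GS bases of ideals of $\mathbf{k}\mathcal{M}(Z)$ are the usual ones for associative algebras. An OPI is an element of $\mathbf{k}\mathfrak{M}(X)$ for a set $X$. For $\phi=\phi(x,y)\in\mathbf{k}\mathfrak{M}(\{x,y\})$, $\phi(r,s)$ denotes the substitution $x\mapsto r$, $y\mapsto s$ in a unital operated algebra; $S_\phi(Z):=\{\phi(u,v)\mid u,v\in\mathfrak{M}(Z)\}\subseteq\mathbf{k}\mathfrak{M}(Z)$. A $\phi$-algebra is a unital operated algebra $B$ with $\phi(r,s)=0$ for all $r,s\in B$; $\mathcal{F}^{\phi\text{-}\mathrm{Alg}}_{\mathrm{uAlg}}$ is the left adjoint of the forgetful functor from $\phi$-algebras to unital algebras (free $\phi$-algebra over a unital algebra), and the displayed equality means that the quotient, with the homomorphism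 from $A$ induced by $\mathbf{k}\mathcal{M}(Z)\subseteq\mathbf{k}\mathfrak{M}(Z)$, is this free object. OPI of Rota–Baxter type: $\phi=\lfloor x\rfloor\lfloor y\rfloor-\lfloor B(x,y)\rfloor\in\mathbf{k}\mathfrak{M}(\{x,y\})$ where (a) $B(x,y)$ is linear in $x$ and in $y$; (b) no monomial of $B(x,y)$ contains a subword $\lfloor u\rfloor\lfloor v\rfloor$ with $u,v\in\mathfrak{M}(\{x,y\})\setminus\{1\}$; (c) for every set $Z$, the rewriting system $\Pi_\phi(Z)=\{q|_{\lfloor u\rfloor\lfloor v\rfloor}\to q|_{\lfloor B(u,v)\rfloor}\mid q\in\mathfrak{M}^\star(Z),\ u,v\in\mathfrak{M}(Z)\}$ is terminating; (d) for every set $Z$ and $u,v,w\in\mathfrak{M}(Z)\setminus\{1\}$, $B(B(u,v),w)-B(u,B(v,w))\stackrel{*}{\to}_{\Pi_\phi(Z)}0$. Here, if $t\to v$ is a rule and $t$ occurs in $f\in\mathbf{k}\mathfrak{M}(Z)$ with nonzero coefficient $c_t$, then $f\to f-c_tt+c_tv$ is a one-step rewriting; $\stackrel{*}{\to}$ is the reflexive-transitive closure; terminating means no infinite chain of one-step rewritings. Orders: $Z$ is equipped with a well-order $\le_Z$. On $\mathcal{M}(Z)$, $u<_{\mathrm{dlex}}v$ if $u$ is shorter than $v$, or they have the same length and $u=mu_in$, $v=mv_in'$ with $m,n,n'\in\mathcal{M}(Z)$, $u_i,v_i\in Z$, $u_i<_Zv_i$. The order $\le_{\mathrm{db}}$ is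 a monomial order on $\mathfrak{M}(Z)$ (from Gao–Guo–Sit–Zheng) with the following properties, for $\phi$ of Rota–Baxter type: its restriction to $\mathcal{M}(Z)$ is $\le_{\mathrm{dlex}}$; the leading monomial of $\phi(u,v)$ is $\lfloor u\rfloor\lfloor v\rfloor$ for all $u,v\in\mathfrak{M}(Z)$; and $S_\phi(Z)$ is an operated GS basis of $\langle S_\phi(Z)\rangle_{\mathrm{uOpAlg}}$ with respect to $\le_{\mathrm{db}}$. *)

(* Defs.v *)
From HB Require Import structures.
From Stdlib Require Import Relations.
From mathcomp Require Import all_boot all_algebra.
From mathcomp Require Import finmap boolp classical_sets.
From mathcomp Require Import monalg.

Set Implicit Arguments.
Unset Strict Implicit.
Unset Printing Implicit Defensive.

Import GRing.Theory.
Local Open Scope classical_set_scope.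
Local Open Scope ring_scope.
Local Open Scope quotient_scope.

(* Unital k-algebras.  The library structure algType forces 1 != 0, whereas
   the ideals below may be improper, so the zero algebra must be allowed;
   pzRingType and lmodType have no join outside lalgType, hence uscale. *)

HB.mixin Record PzRing_isUAlgebra (k : fieldType) A of GRing.PzRing A := {
  uscale : k -> A -> A;
  uscaleA : forall c d x, uscale c (uscale d x) = uscale (c * d) x;
  uscale1 : forall x, uscale 1 x = x;
  uscaleDr : forall c x y, uscale c (x + y) = uscale c x + uscale c y;
  uscaleDl : forall x c d, uscale (c + d) x = uscale c x + uscale d x;
  uscaleAl : forall c x y, uscale c (x * y) = uscale c x * y;
  uscaleAr : forall c x y, uscale c (x * y) = x * uscale c y
}.

#[short(type="uAlgType")]
HB.structure Definition UAlgebra (k : fieldType) :=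
  {A of GRing.PzRing A & PzRing_isUAlgebra k A}.

HB.mixin Record UAlgebra_hasOperator (k : fieldType) A of UAlgebra k A := {
  oper : A -> A;
  operD : forall x y, oper (x + y) = oper x + oper y;
  operZ : forall (c : k) x, oper (uscale c x) = uscale c (oper x)
}.

#[short(type="uOpAlgType")]
HB.structure Definition UOpAlgebra (k : fieldType) :=
  {A of UAlgebra k A & UAlgebra_hasOperator k A}.

Definition alg_hom (k : fieldType) (A B : uAlgType k) (f : A -> B) : Prop :=
  [/\ {morph f : x y / x + y},
      forall c : k, {morph f : x / uscale c x},
      {morph f : x y / x * y} & f 1 = 1].

Definition opalg_hom (k : fieldType) (A B : uOpAlgType k) (f : A -> B) : Prop :=
  alg_hom f /\ {morph f : x / oper x}.

(* Two-sided ideals, possibly improper; since x * uscale c 1 = uscale c x,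
   they are stable under scalars. *)

Record ideal (A : pzRingType) := Ideal {
  ideal_set :> A -> Prop;
  ideal0 : ideal_set 0;
  idealD : forall x y, ideal_set x -> ideal_set y -> ideal_set (x + y);
  idealMl : forall a x, ideal_set x -> ideal_set (a * x);
  idealMr : forall a x, ideal_set x -> ideal_set (x * a)
}.

Record opideal (k : fieldType) (A : uOpAlgType k) := OpIdeal {
  opideal_ideal :> ideal A;
  opideal_oper : forall x, opideal_ideal x -> opideal_ideal (oper x)
}.

Section GeneratedIdeal.
Context (A : pzRingType) (S : set A).

Definition gen_ideal_set : set A :=
  [set x | forall I : ideal A, S `<=` ideal_set I -> I x].

Fact gen_ideal0 : gen_ideal_set 0.
Proof. by move=> I _; apply: ideal0. Qed.

Fact gen_idealD x y :
  gen_ideal_set x -> gen_ideal_set y -> gen_ideal_set (x + y).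
Proof. by move=> Sx Sy I SI; apply: idealD; [apply: Sx|apply: Sy]. Qed.

Fact gen_idealMl a x : gen_ideal_set x -> gen_ideal_set (a * x).
Proof. by move=> Sx I SI; apply/idealMl/Sx. Qed.

Fact gen_idealMr a x : gen_ideal_set x -> gen_ideal_set (x * a).
Proof. by move=> Sx I SI; apply/idealMr/Sx. Qed.

Definition gen_ideal : ideal A :=
  Ideal gen_ideal0 gen_idealD gen_idealMl gen_idealMr.

End GeneratedIdeal.

Section GeneratedOpIdeal.
Context (k : fieldType) (A : uOpAlgType k) (S : set A).

Definition gen_opideal_set : set A :=
  [set x | forall I : opideal A, S `<=` ideal_set I -> I x].

Fact gen_opideal0 : gen_opideal_set 0.
Proof. by move=> I _; apply: ideal0. Qed.

Fact gen_opidealD x y :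
  gen_opideal_set x -> gen_opideal_set y -> gen_opideal_set (x + y).
Proof. by move=> Sx Sy I SI; apply: idealD; [apply: Sx|apply: Sy]. Qed.

Fact gen_opidealMl a x : gen_opideal_set x -> gen_opideal_set (a * x).
Proof. by move=> Sx I SI; apply/idealMl/Sx. Qed.

Fact gen_opidealMr a x : gen_opideal_set x -> gen_opideal_set (x * a).
Proof. by move=> Sx I SI; apply/idealMr/Sx. Qed.

Fact gen_opideal_oper x : gen_opideal_set x -> gen_opideal_set (oper x).
Proof. by move=> Sx I SI; apply/opideal_oper/Sx. Qed.

Definition gen_opideal : opideal A :=
  @OpIdeal k A (Ideal gen_opideal0 gen_opidealD gen_opidealMl gen_opidealMr)
    gen_opideal_oper.

End GeneratedOpIdeal.

Section IdealPred.
Context (A : pzRingType) (I : ideal A).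

Definition ideal_pred : A -> bool := fun x => `[< I x >].

Fact ideal_pred_zmod_closed : zmod_closed ideal_pred.
Proof.
split=> [|x y /asboolP Ix /asboolP Iy]; apply/asboolP; first exact: ideal0.
by apply: idealD => //; rewrite -mulN1r; apply: idealMl.
Qed.

HB.instance Definition _ :=
  GRing.isZmodClosed.Build A ideal_pred ideal_pred_zmod_closed.

Definition ideal_zmod := GRing.ZmodClosed.clone A ideal_pred _.

Definition quotient : Type := Quotient.quot ideal_zmod.

HB.instance Definition _ := GRing.Zmodule.on quotient.

Definition to_quotient (x : A) : quotient := \pi_(Quotient.quot ideal_zmod) x.

Fact to_quotient_surj (a : quotient) : exists x, to_quotient x = a.
Proof. by exists (repr a); rewrite /to_quotient reprK. Qed.

Fact to_quotientP x y : to_quotient x = to_quotient y <-> I (x - y).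
Proof.
split=> [/eqP|Ixy]; first by rewrite -Quotient.idealrBE => /asboolP.
by apply/eqP; rewrite -Quotient.idealrBE; apply/asboolP.
Qed.

Fact to_quotientD x y : to_quotient (x + y) = to_quotient x + to_quotient y.
Proof. by rewrite /to_quotient pi_addr. Qed.

Fact repr_to_quotient x : I (repr (to_quotient x) - x).
Proof. by apply/to_quotientP; rewrite /to_quotient reprK. Qed.

Definition quotient_one : quotient := to_quotient 1.
Definition quotient_mul (a b : quotient) : quotient :=
  to_quotient (repr a * repr b).

Fact to_quotientM x y :
  to_quotient (x * y) = quotient_mul (to_quotient x) (to_quotient y).
Proof.
apply/esym/to_quotientP.
set x' := repr _; set y' := repr _.
have -> : x' * y' - x * y = (x' - x) * y' + x * (y' - y).
  by rewrite mulrBl mulrBr addrA addrNK.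
by apply: idealD; [apply/idealMr/repr_to_quotient|apply/idealMl/repr_to_quotient].
Qed.

Fact quotient_mulA : associative quotient_mul.
Proof.
move=> a b c.
case: (to_quotient_surj a) (to_quotient_surj b) (to_quotient_surj c).
by move=> x <- [y <-] [z <-]; rewrite -!to_quotientM mulrA.
Qed.

Fact quotient_mul1l : left_id quotient_one quotient_mul.
Proof.
by move=> a; case: (to_quotient_surj a) => x <-; rewrite -to_quotientM mul1r.
Qed.

Fact quotient_mul1r : right_id quotient_one quotient_mul.
Proof.
by move=> a; case: (to_quotient_surj a) => x <-; rewrite -to_quotientM mulr1.
Qed.

Fact quotient_mulDl : left_distributive quotient_mul +%R.
Proof.
move=> a b c.
case: (to_quotient_surj a) (to_quotient_surj b) (to_quotient_surj c).
move=> x <- [y <-] [z <-].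
by rewrite -to_quotientD -!to_quotientM mulrDl to_quotientD.
Qed.

Fact quotient_mulDr : right_distributive quotient_mul +%R.
Proof.
move=> a b c.
case: (to_quotient_surj a) (to_quotient_surj b) (to_quotient_surj c).
move=> x <- [y <-] [z <-].
by rewrite -to_quotientD -!to_quotientM mulrDr to_quotientD.
Qed.

HB.instance Definition _ := GRing.Zmodule_isPzRing.Build quotient
  quotient_mulA quotient_mul1l quotient_mul1r quotient_mulDl quotient_mulDr.

End IdealPred.

Section QuotientAlgebra.
Context (k : fieldType) (A : uAlgType k) (I : ideal A).
Local Notation quo := (quotient I).

Definition quotient_scale (c : k) (a : quo) : quo :=
  to_quotient I (uscale c (repr a)).

Fact uscale_is_mul (c : k) (x : A) : uscale c x = uscale c 1 * x.
Proof. by rewrite -uscaleAl mul1r. Qed.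

Fact to_quotientZ (c : k) x :
  to_quotient I (uscale c x) = quotient_scale c (to_quotient I x).
Proof.
apply/esym/to_quotientP.
rewrite [uscale c x]uscale_is_mul uscale_is_mul -mulrBr.
exact/idealMl/repr_to_quotient.
Qed.

Fact quotient_scaleA c d (a : quo) :
  quotient_scale c (quotient_scale d a) = quotient_scale (c * d) a.
Proof.
by case: (to_quotient_surj a) => x <-; rewrite -!to_quotientZ uscaleA.
Qed.

Fact quotient_scale1 (a : quo) : quotient_scale 1 a = a.
Proof.
by case: (to_quotient_surj a) => x <-; rewrite -to_quotientZ uscale1.
Qed.

Fact quotient_scaleDr c (a b : quo) :
  quotient_scale c (a + b) = quotient_scale c a + quotient_scale c b.
Proof.
case: (to_quotient_surj a) (to_quotient_surj b) => x <- [y <-].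
by rewrite -to_quotientD -!to_quotientZ uscaleDr to_quotientD.
Qed.

Fact quotient_scaleDl (a : quo) c d :
  quotient_scale (c + d) a = quotient_scale c a + quotient_scale d a.
Proof.
case: (to_quotient_surj a) => x <-.
by rewrite -!to_quotientZ uscaleDl to_quotientD.
Qed.

Fact quotient_scaleAl c (a b : quo) :
  quotient_scale c (a * b) = quotient_scale c a * b.
Proof.
case: (to_quotient_surj a) (to_quotient_surj b) => x <- [y <-].
by rewrite -[_ * _]to_quotientM -!to_quotientZ uscaleAl to_quotientM.
Qed.

Fact quotient_scaleAr c (a b : quo) :
  quotient_scale c (a * b) = a * quotient_scale c b.
Proof.
case: (to_quotient_surj a) (to_quotient_surj b) => x <- [y <-].
by rewrite -[_ * _]to_quotientM -!to_quotientZ uscaleAr to_quotientM.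
Qed.

HB.instance Definition _ := PzRing_isUAlgebra.Build k quo
  quotient_scaleA quotient_scale1 quotient_scaleDr quotient_scaleDl
  quotient_scaleAl quotient_scaleAr.

End QuotientAlgebra.

Section QuotientOpAlgebra.
Context (k : fieldType) (A : uOpAlgType k) (J : opideal A).

Definition op_quotient : Type := quotient J.

HB.instance Definition _ := UAlgebra.on op_quotient.

Definition to_op_quotient (x : A) : op_quotient := to_quotient J x.

Definition op_quotient_oper (a : op_quotient) : op_quotient :=
  to_op_quotient (oper (repr a)).

Fact to_op_quotient_oper x :
  to_op_quotient (oper x) = op_quotient_oper (to_op_quotient x).
Proof.
apply/esym/to_quotientP.
have operN y : oper (- y) = - oper y :> A.
  apply: (addrI (oper y)); rewrite -operD !subrr.
  by apply: (addrI (oper 0)); rewrite -operD !addr0.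
by rewrite -operN -operD; apply/opideal_oper/repr_to_quotient.
Qed.

Fact op_quotient_operD a b :
  op_quotient_oper (a + b) = op_quotient_oper a + op_quotient_oper b.
Proof.
case: (to_quotient_surj a) (to_quotient_surj b) => x <- [y <-].
by rewrite -to_quotientD -!to_op_quotient_oper operD [LHS]to_quotientD.
Qed.

Fact op_quotient_operZ (c : k) a :
  op_quotient_oper (uscale c a) = uscale c (op_quotient_oper a).
Proof.
case: (to_quotient_surj a) => x <-.
by rewrite -[uscale c _]to_quotientZ -!to_op_quotient_oper operZ [LHS]to_quotientZ.
Qed.

HB.instance Definition _ := UAlgebra_hasOperator.Build k op_quotient
  op_quotient_operD op_quotient_operZ.

End QuotientOpAlgebra.

Section MonoidAlgebra.
Context (k : fieldType) (M : monomType).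
Local Notation kM := {malg k[M]}.

Fact malg_scaleAr (c : k) (f g : kM) : c *: (f * g) = f * (c *: g).
Proof.
have ZU d (m : M) : c *: << d *g m >> = << c * d *g m >> :> kM.
  by apply/malgP => n; rewrite mcoeffZ !mcoeffU mulrnAr.
rewrite (monalgE f) (monalgE g) mulr_suml scaler_sumr mulr_suml.
apply: eq_bigr => m _; rewrite mulr_sumr !scaler_sumr mulr_sumr.
by apply: eq_bigr => n _; rewrite ZU !malgM_def !fgmulUU ZU mulrCA.
Qed.

HB.instance Definition _ := PzRing_isUAlgebra.Build k kM
  (@scalerA k kM) (@scale1r k kM) (fun c => @scalerDr k kM c)
  (fun x c d => @scalerDl k kM x c d) (fun c x y => @scalerAl k kM c x y)
  malg_scaleAr.

Definition linext (B : uAlgType k) (h : M -> B) (f : kM) : B :=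
  \sum_(m <- msupp f) uscale f@_m (h m).

Fact uscale0 (B : uAlgType k) (x : B) : uscale (0 : k) x = 0.
Proof. by apply: (addrI (uscale 0 x)); rewrite -uscaleDl !addr0. Qed.

Fact linextw (B : uAlgType k) (h : M -> B) (d : {fset M}) f :
  fsubset (msupp f) d -> linext h f = \sum_(m <- d) uscale f@_m (h m).
Proof.
move=> le_fd; rewrite /linext (big_fset_incl _ le_fd) //= => m _.
by move/mcoeff_outdom => ->; rewrite uscale0.
Qed.

Fact linextD (B : uAlgType k) (h : M -> B) :
  {morph linext h : f g / f + g}.
Proof.
move=> f g; have le := msuppD_le f g.
rewrite (linextw _ le) (linextw _ (fsubsetUl _ (msupp g))).
rewrite (linextw _ (fsubsetUr (msupp f) _)) -big_split /=.
by apply: eq_bigr => m _; rewrite mcoeffD uscaleDl.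
Qed.

Fact linextZ (B : uAlgType k) (h : M -> B) (c : k) f :
  linext h (uscale c f) = uscale c (linext h f).
Proof.
rewrite (linextw _ (msuppZ_le c f)) /linext.
have usum (r : seq M) (F : M -> B) :
    uscale c (\sum_(m <- r) F m) = \sum_(m <- r) uscale c (F m).
  elim: r => [|m r IHr]; last by rewrite !big_cons uscaleDr IHr.
  by rewrite !big_nil; apply: (addrI (uscale c 0)); rewrite -uscaleDr !addr0.
by rewrite usum; apply: eq_bigr => m _; rewrite mcoeffZ uscaleA.
Qed.

End MonoidAlgebra.

(* Bracketed words.  The free monoid on T is the library's {fmonom T}, whose
   elements coerce to their sequences of letters.  A letter of a bracketed word
   is an element of Z or a bracket, and the word inside a bracket is stored as
   its sequence of letters: bword Z is the free monoid on Z + [bword Z]. *)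

Inductive bletter (Z : Type) : Type :=
  | Atom of Z
  | Brack of seq (bletter Z).
Arguments Brack {Z} _.

Section BletterChoice.
Context (Z : choiceType).

Fixpoint bletter_encode (a : bletter Z) : GenTree.tree Z :=
  match a with
  | Atom z => GenTree.Leaf z
  | Brack s => GenTree.Node 0 (map bletter_encode s)
  end.

Fixpoint bletter_decode (t : GenTree.tree Z) : bletter Z :=
  match t with
  | GenTree.Leaf z => Atom z
  | GenTree.Node _ ts => Brack (map bletter_decode ts)
  end.

Fixpoint bletter_encodeK (a : bletter Z) :
    bletter_decode (bletter_encode a) = a :=
  match a with
  | Atom z => erefl
  | Brack s =>
    f_equal Brack
      ((fix encodesK (s : seq (bletter Z)) :
          map bletter_decode (map bletter_encode s) = s :=
        match s with
        | [::] => erefl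
        | b :: s' => f_equal2 cons (bletter_encodeK b) (encodesK s')
        end) s)
  end.

HB.instance Definition _ :=
  Choice.copy (bletter Z) (can_type bletter_encodeK).

End BletterChoice.

Notation bword Z := {fmonom (bletter Z)}.

Definition brack (Z : choiceType) (u : bword Z) : bword Z :=
  FMonom [:: Brack u].

Definition atom (Z : choiceType) (z : Z) : bword Z := FMonom [:: Atom z].

Definition word_incl (Z : choiceType) (u : {fmonom Z}) : bword Z :=
  FMonom [seq Atom z | z <- u].

Fixpoint bletter_occ (Z : Type) (p : pred Z) (a : bletter Z) : nat :=
  match a with
  | Atom z => p z
  | Brack s => sumn (map (bletter_occ p) s)
  end.

Definition occ (Z : choiceType) (p : pred Z) (u : bword Z) : nat :=
  sumn (map (bletter_occ p) u).

(* Words over Z with exactly one star; None : option Z is the star. *)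
Definition star_word (Z : choiceType) : Type :=
  {q : bword (option Z) | occ (fun z => z == None) q == 1%N}.

Fixpoint bletter_subst (Z : Type) (u : seq (bletter Z))
    (a : bletter (option Z)) : seq (bletter Z) :=
  match a with
  | Atom None => u
  | Atom (Some z) => [:: Atom z]
  | Brack s => [:: Brack (flatten (map (bletter_subst u) s))]
  end.

Definition star_subst (Z : choiceType) (q : star_word Z) (u : bword Z) :
    bword Z :=
  FMonom (flatten (map (bletter_subst u) (sval q))).

Section FreeOperatedAlgebra.
Context (k : fieldType) (Z : choiceType).
Local Notation kZ := {malg k[bword Z]}.

Definition malg_oper : kZ -> kZ := linext (fun u : bword Z => << brack u >> : kZ).

Fact malg_operD (f g : kZ) : malg_oper (f + g) = malg_oper f + malg_oper g.
Proof. exact: linextD. Qed.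

Fact malg_operZ (c : k) (f : kZ) :
  malg_oper (uscale c f) = uscale c (malg_oper f).
Proof. exact: linextZ. Qed.

HB.instance Definition _ :=
  UAlgebra_hasOperator.Build k kZ malg_operD malg_operZ.

Definition malg_incl : {malg k[{fmonom Z}]} -> kZ :=
  linext (fun u => << word_incl u >> : kZ).

Fixpoint bletter_eval (A : uOpAlgType k) (h : Z -> A) (a : bletter Z) : A :=
  match a with
  | Atom z => h z
  | Brack s => oper (foldr (fun b p => bletter_eval h b * p) 1 s)
  end.

Definition bword_eval (A : uOpAlgType k) (h : Z -> A) (u : bword Z) : A :=
  foldr (fun b p => bletter_eval h b * p) 1 (u : seq (bletter Z)).

Definition malg_eval (A : uOpAlgType k) (h : Z -> A) : kZ -> A :=
  linext (bword_eval h).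

End FreeOperatedAlgebra.

Definition strict (T : Type) (le : T -> T -> Prop) (x y : T) : Prop :=
  le x y /\ x <> y.

Definition well_order (T : Type) (le : T -> T -> Prop) : Prop :=
  [/\ forall x y, le x y \/ le y x,
      forall x y, le x y -> le y x -> x = y,
      forall x y z, le x y -> le y z -> le x z &
      well_founded (strict le)].

Definition monomial_order (Z : choiceType) (le : bword Z -> bword Z -> Prop) :
    Prop :=
  well_order le /\
  forall (q : star_word Z) (u v : bword Z),
    strict le u v -> strict le (star_subst q u) (star_subst q v).

Definition dlex_lt (Z : choiceType) (leZ : Z -> Z -> Prop)
    (u v : {fmonom Z}) : Prop :=
  (size u < size v)%N \/
  size u = size v /\
  exists (m n n' : {fmonom Z}) (z z' : Z),
    [/\ u = mmul m (mmul (fmu z) n), v = mmul m (mmul (fmu z') n') &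
        strict leZ z z'].

Definition dlex (Z : choiceType) (leZ : Z -> Z -> Prop) (u v : {fmonom Z}) :
    Prop :=
  u = v \/ dlex_lt leZ u v.

(* Groebner-Shirshov bases in k[{fmonom T}], for a type C of one-hole contexts
   with substitution plug: two-sided factors for associative algebras
   (T := Z), star words for operated algebras (T := bletter Z).  In both cases
   the breadth of a word is the length of its sequence of letters. *)
Section GSBasis.
Context (k : fieldType) (T : choiceType) (le : {fmonom T} -> {fmonom T} -> Prop).
Context (C : Type) (plug : C -> {fmonom T} -> {fmonom T}).
Local Notation kT := {malg k[{fmonom T}]}.
Implicit Types (f g h : kT) (u v w : {fmonom T}) (q : C) (G : set kT).

(* the largest monomial of f; the default 1 is taken only for f = 0 *)
Definition lead f : {fmonom T} :=
  xget mone [set m | m \in msupp f /\ forall m', m' \in msupp f -> le m' m].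

Definition monicize f : kT := (f@_(lead f))^-1 *: f.

Definition plug_lin q : kT -> kT := linext (fun u => << plug q u >> : kT).

Definition trivial_mod G w h : Prop :=
  exists (n : nat) (c : 'I_n -> k) (q : 'I_n -> C) (s : 'I_n -> kT),
    (forall i, G (s i) /\ strict le (plug (q i) (lead (s i))) w) /\
    h = \sum_(i < n) c i *: plug_lin (q i) (s i).

Definition GS_basis G : Prop :=
  forall f g, G f -> G g -> f != 0 -> g != 0 ->
    (forall u v w, w = mmul (lead f) u -> w = mmul v (lead g) ->
       (maxn (size (lead f)) (size (lead g)) < size w
          < size (lead f) + size (lead g))%N ->
       trivial_mod G w (monicize f * << u >> - << v >> * monicize g)) /\
    (forall q w, w = lead f -> w = plug q (lead g) ->
       trivial_mod G w (monicize f - plug_lin q (monicize g))).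

End GSBasis.

Definition assoc_plug (Z : choiceType) (ab : {fmonom Z} * {fmonom Z})
    (u : {fmonom Z}) : {fmonom Z} :=
  mmul ab.1 (mmul u ab.2).

Definition is_GS_basis_of (k : fieldType) (Z : choiceType)
    (le : {fmonom Z} -> {fmonom Z} -> Prop) (G : set {malg k[{fmonom Z}]})
    (I : ideal {malg k[{fmonom Z}]}) : Prop :=
  GS_basis le (@assoc_plug Z) G /\ ideal_set (gen_ideal G) = ideal_set I.

Definition is_op_GS_basis_of (k : fieldType) (Z : choiceType)
    (le : bword Z -> bword Z -> Prop) (G : set {malg k[bword Z]})
    (J : opideal {malg k[bword Z]}) : Prop :=
  GS_basis le (@star_subst Z) G /\ ideal_set (gen_opideal G) = ideal_set J.

(* Operated polynomial identities in the variables x = true, y = false. *)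

Notation opi k := {malg k[bword bool]}.

Section OPI.
Context (k : fieldType).

Definition opi_x : opi k := << atom true >>.
Definition opi_y : opi k := << atom false >>.

Definition opi_at (phi : opi k) (A : uOpAlgType k) (r s : A) : A :=
  malg_eval (fun b : bool => if b then r else s) phi.

Definition S_opi (phi : opi k) (Z : choiceType) : set {malg k[bword Z]} :=
  [set f | exists u v : bword Z, f = opi_at phi << u >> << v >>].

Definition phi_algebra (phi : opi k) (A : uOpAlgType k) : Prop :=
  forall r s : A, opi_at phi r s = 0.

(* F, with i : A -> F, is the free phi-algebra on the unital algebra A *)
Definition is_free_phi_algebra (phi : opi k) (A : uAlgType k)
    (F : uOpAlgType k) (i : A -> F) : Prop :=
  [/\ phi_algebra phi F, alg_hom i &
      forall (B : uOpAlgType k) (f : A -> B), phi_algebra phi B -> alg_hom f ->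
        exists! h : F -> B, opalg_hom h /\ h \o i = f].

(* the rules t -> r of the rewriting system of [x][y] - [B(x,y)] *)
Definition rewrite_rule (B : opi k) (Z : choiceType) (t : bword Z)
    (r : {malg k[bword Z]}) : Prop :=
  exists (q : star_word Z) (u v : bword Z),
    t = star_subst q (mmul (brack u) (brack v)) /\
    r = plug_lin (@star_subst Z) q (oper (opi_at B << u >> << v >>)).

Definition rewrite_step (B : opi k) (Z : choiceType)
    (f g : {malg k[bword Z]}) : Prop :=
  exists t r, [/\ rewrite_rule B t r, f@_t != 0 &
                  g = f - f@_t *: << t >> + f@_t *: r].

Definition terminating (B : opi k) (Z : choiceType) : Prop :=
  ~ exists F : nat -> {malg k[bword Z]},
      forall n, rewrite_step B (F n) (F n.+1).

Definition rota_baxter_type (phi : opi k) : Prop :=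
  exists B : opi k,
  [/\ phi = oper opi_x * oper opi_y - oper B,
      forall m, m \in msupp B ->
        occ (pred1 true) m = 1%N /\ occ (pred1 false) m = 1%N,
      forall m, m \in msupp B ->
        ~ exists (q : star_word bool) (u v : bword bool),
            [/\ u != mone, v != mone &
                m = star_subst q (mmul (brack u) (brack v))],
      forall Z : choiceType, terminating B Z &
      forall (Z : choiceType) (u v w : bword Z),
        u != mone -> v != mone -> w != mone ->
        let b (r s : {malg k[bword Z]}) := opi_at B r s in
        clos_refl_trans _ (@rewrite_step B Z)
          (b (b << u >> << v >>) << w >> - b << u >> (b << v >> << w >>)) 0].

End OPI.

(* Main.v *)
Require Import Defs.
From mathcomp Require Import all_boot all_algebra.
From mathcomp Require Import finmap boolp classical_sets.
From mathcomp Require Import monalg.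

Set Implicit Arguments.
Unset Strict Implicit.
Unset Printing Implicit Defensive.

Import GRing.Theory.
Local Open Scope classical_set_scope.
Local Open Scope ring_scope.


(** Free algebras.  The identity [phi] is linear in each variable, so it holds in
    the quotient as soon as it holds on monomials; the universal property of the
    quotient is then that of bracketed polynomials, on which homomorphisms are
    determined by the images of the letters ([presented_free_phi_algebra]).

    Groebner-Shirshov bases.  The leading monomial [ [u][v] ] of [phi(u, v)] is a
    word of two brackets, while the leading monomial [m] of a relation [g] of the
    associative algebra is a word of atoms.  Such words never overlap, and
    [ [u][v] ] never occurs in [m].  Besides compositions inside each family,
    there remain those where [m] occurs in [u] or in [v], unless [m] is [1], in
    which case everything is trivial ([lead1_trivial]).  Say that [u] is [p(m)]
    for a context [p], with [g] monic.  By linearity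

      phi(u, v) - [p(g)][v] = - phi(p(g - m), v) - [B(p(g), v)].

    The first term is a combination of instances of [phi] with leading monomials
    below [ [u][v] ].  The second one is in the operated ideal of [g], and its
    monomials are below [ [u][v] ], because those of [ [B(u', v)] ] are below
    [ [u'][v] ] for each [u'] ([frame_composition]).  It cannot be
    expanded term by term: two monomials of [B] may coincide and cancel at
    [(u, v)] without doing so at [(p(g), v)], and then nothing bounds them.
    Instead, the composition lemma for the relations of the associative algebra
    alone yields a representation below [ [u][v] ] ([composition_lemma]).

    That lemma needs the critical pairs of these relations in bracketed words
    ([incl_confluent]).  Two occurrences of words of atoms either share letters
    in one sequence of letters, and then they are an associative composition
    inside a context, or are independent, possibly at different depths;
    independent occurrences are resolved by plugging both relations
    ([separate_or_overlapping], [separate_confluent]). *)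

(** * Linear maps on monoid algebras *)

Section LinearMaps.
Context (k : fieldType).

Definition lin (A B : uAlgType k) (f : A -> B) : Prop :=
  {morph f : x y / x + y} /\ forall c : k, {morph f : x / uscale c x}.

Lemma uscaler0 (A : uAlgType k) (c : k) : uscale c 0 = 0 :> A.
Proof. by apply: (addrI (uscale c 0)); rewrite -uscaleDr !addr0. Qed.

Lemma uscaleN1 (A : uAlgType k) (x : A) : uscale (- 1 : k) x = - x.
Proof.
apply: (addrI x).
by rewrite -{1}[x](@uscale1 k) -uscaleDl !subrr uscale0.
Qed.

Lemma lin0 (A B : uAlgType k) (f : A -> B) : lin f -> f 0 = 0.
Proof. by move=> [_ fZ]; rewrite -[X in f X](uscale0 0) fZ uscale0. Qed.

Lemma linN (A B : uAlgType k) (f : A -> B) x : lin f -> f (- x) = - f x.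
Proof. by move=> [_ fZ]; rewrite -!uscaleN1 fZ. Qed.

Lemma linB (A B : uAlgType k) (f : A -> B) x y : lin f -> f (x - y) = f x - f y.
Proof. by move=> linf; case: (linf) => fD _; rewrite fD linN. Qed.

Lemma lin_comp (A B C : uAlgType k) (f : A -> B) (g : B -> C) :
  lin f -> lin g -> lin (g \o f).
Proof.
by move=> [fD fZ] [gD gZ]; split=> [x y|c x] /=; rewrite ?fD ?gD ?fZ ?gZ.
Qed.

Lemma lin_add (A B : uAlgType k) (f g : A -> B) :
  lin f -> lin g -> lin (fun x => f x + g x).
Proof.
move=> [fD fZ] [gD gZ]; split=> [x y|c x]; first by rewrite fD gD addrACA.
by rewrite fZ gZ uscaleDr.
Qed.

Lemma lin_scale (A B : uAlgType k) (c : k) (f : A -> B) :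
  lin f -> lin (fun x => uscale c (f x)).
Proof.
move=> [fD fZ]; split=> [x y|d x]; first by rewrite fD uscaleDr.
by rewrite fZ !uscaleA mulrC.
Qed.

Lemma lin_mull (A : uAlgType k) (a : A) : lin (fun x => a * x).
Proof. by split=> [x y|c x]; rewrite ?mulrDr ?uscaleAr. Qed.

Lemma lin_mulr (A : uAlgType k) (a : A) : lin (fun x => x * a).
Proof. by split=> [x y|c x]; rewrite ?mulrDl ?uscaleAl. Qed.

Lemma lin_oper (A : uOpAlgType k) : lin (@oper k A).
Proof. by split=> [x y|c x]; rewrite ?operD ?operZ. Qed.

Lemma alg_hom_lin (A B : uAlgType k) (f : A -> B) : alg_hom f -> lin f.
Proof. by case. Qed.

Context (M : monomType).
Local Notation kM := {malg k[M]}.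

Lemma malg_ind (Q : M -> Prop) (P : kM -> Prop) :
  P 0 -> (forall c m f, Q m -> P f -> P (c *: << m >> + f)) ->
  forall f, (forall m, f@_m != 0 -> Q m) -> P f.
Proof.
move=> P0 PD f Qf; rewrite (monalgE f) big_seq.
have {Qf} Qf m : m \in msupp f -> Q m by rewrite -mcoeff_neq0 => /Qf.
apply: big_rec => // m g /Qf Qm Pg.
suff -> : << f@_m *g m >> = f@_m *: << m >> :> kM by apply: PD.
by apply/malgP => n; rewrite mcoeffZ !mcoeffU mulrnAr mulr1.
Qed.

Lemma lin_eq (B : uAlgType k) (f g : kM -> B) :
  lin f -> lin g -> (forall m, f << m >> = g << m >>) -> f =1 g.
Proof.
move=> linf ling fg x.
apply: (@malg_ind (fun=> True) (fun x => f x = g x)) => //.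
  by rewrite (lin0 linf) (lin0 ling).
case: linf ling => fD fZ [gD gZ] c m h _ fgh.
by rewrite fD gD fgh -[_ *: _]/(uscale c _) fZ gZ fg.
Qed.

Lemma lin_linext (B : uAlgType k) (h : M -> B) : lin (linext h).
Proof. by split=> [|c] ?; [exact: linextD|exact: linextZ]. Qed.

Lemma linextU (B : uAlgType k) (h : M -> B) m : linext h << m >> = h m.
Proof. by rewrite /linext msuppU1 big_seq_fset1 mcoeffUU uscale1. Qed.

End LinearMaps.

Section MonomialMaps.
Context (k : fieldType).

(** Plugging into a context, the embedding of associative polynomials, the
    operator and the product with a monomial all extend linearly a function on
    monomials, so they share this normal form. *)
Definition mapw (M N : monomType) (F : M -> N) : {malg k[M]} -> {malg k[N]} :=
  linext (fun u => << F u >> : {malg k[N]}).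

Lemma lin_mapw (M N : monomType) (F : M -> N) : lin (mapw F).
Proof. exact: lin_linext. Qed.

Lemma mapwU (M N : monomType) (F : M -> N) m : mapw F << m >> = << F m >>.
Proof. exact: linextU. Qed.

Lemma mapwD (M N : monomType) (F : M -> N) : {morph mapw F : f g / f + g}.
Proof. by case: (lin_mapw F). Qed.

Lemma mapwZ (M N : monomType) (F : M -> N) c f :
  mapw F (c *: f) = c *: mapw F f.
Proof. by case: (lin_mapw F) => _; apply. Qed.

Lemma mapw0 (M N : monomType) (F : M -> N) : mapw F 0 = 0.
Proof. exact/lin0/lin_mapw. Qed.

Lemma mapwB (M N : monomType) (F : M -> N) f g :
  mapw F (f - g) = mapw F f - mapw F g.
Proof. exact/linB/lin_mapw. Qed.

Lemma eq_mapw (M N : monomType) (F G : M -> N) : F =1 G -> mapw F =1 mapw G.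
Proof.
by move=> FG; apply: lin_eq => [||m]; rewrite ?mapwU ?FG //; apply: lin_mapw.
Qed.

Lemma mapw_comp (M N P : monomType) (F : M -> N) (G : N -> P) f :
  mapw G (mapw F f) = mapw (G \o F) f.
Proof.
apply: (lin_eq (f := mapw G \o mapw F)) => [||m]; rewrite /= ?mapwU //.
- by apply: lin_comp; apply: lin_mapw.
- exact: lin_mapw.
Qed.

Lemma mapw_id (M : monomType) (f : {malg k[M]}) : mapw id f = f.
Proof.
by apply: (lin_eq (g := id)) => [||m]; rewrite ?mapwU //; apply: lin_mapw.
Qed.

Lemma malgUM (M : monomType) (m n : M) :
  << m >> * << n >> = << mmul m n >> :> {malg k[M]}.
Proof. by rewrite malgM_def fgmulUU mulr1. Qed.

Lemma mulUmapw (M : monomType) (m : M) (f : {malg k[M]}) :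
  << m >> * f = mapw (mmul m) f.
Proof.
apply: (lin_eq (f := fun f => << m >> * f)) => [||n].
- exact: lin_mull.
- exact: lin_mapw.
- by rewrite mapwU malgUM.
Qed.

Lemma mulmapwU (M : monomType) (m : M) (f : {malg k[M]}) :
  f * << m >> = mapw (fun n => mmul n m) f.
Proof.
apply: (lin_eq (f := fun f => f * << m >>)) => [||n].
- exact: lin_mulr.
- exact: lin_mapw.
- by rewrite mapwU malgUM.
Qed.

Lemma operU (Z : choiceType) (u : bword Z) :
  oper << u >> = << brack u >> :> {malg k[bword Z]}.
Proof. exact: linextU. Qed.

Lemma plug_linE (T : choiceType) (C : Type)
    (plug : C -> {fmonom T} -> {fmonom T}) q :
  plug_lin plug q = mapw (plug q) :> ({malg k[{fmonom T}]} -> _).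
Proof. by []. Qed.

Lemma mcoeff_mapw_eq0 (M N : monomType) (F : M -> N) (f : {malg k[M]}) n :
  (forall m, f@_m != 0 -> F m <> n) -> (mapw F f)@_n = 0.
Proof.
move: f; apply: malg_ind => [|c m f Fmn fn]; first by rewrite mapw0 mcoeff0.
rewrite mapwD mapwZ mapwU mcoeffD mcoeffZ mcoeffU fn addr0.
by case: eqP Fmn => // _ _; rewrite mulr0.
Qed.

Lemma mcoeff_mapw (M N : monomType) (F : M -> N) (f : {malg k[M]}) m :
  injective F -> (mapw F f)@_(F m) = f@_m.
Proof.
move=> Finj; apply: (@malg_ind k M (fun=> True)
  (fun f => (mapw F f)@_(F m) = f@_m)) => // [|c n g _ IH].
  by rewrite mapw0 !mcoeff0.
by rewrite mapwD mapwZ mapwU !mcoeffD !mcoeffZ !mcoeffU IH (inj_eq Finj).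
Qed.

End MonomialMaps.
Arguments lin_mapw {k M N} F.
Arguments mapw0 {k M N} F.

(** * Evaluation of bracketed words *)

(** Bracketed words are forests: this single induction on sequences of letters
    replaces the mutual recursion between letters and words. *)
Lemma forest_ind (T : Type) (P : seq (bletter T) -> Prop) :
  P [::] -> (forall z s, P s -> P (Atom z :: s)) ->
  (forall t s, P t -> P s -> P (Brack t :: s)) -> forall s, P s.
Proof.
move=> P0 PA PB.
pose Q (a : bletter T) := if a is Brack t then P t else True.
have Q_cons a s : Q a -> P s -> P (a :: s) by case: a => [z _|t]; auto.
have letterQ : forall a, Q a.
  fix IH 1 => -[z|t]; first exact: I.
  by elim: t => [|b t IHt]; [exact: P0|apply: Q_cons].
by elim=> [//|a s Ps]; apply: Q_cons.
Qed.

Section Evaluation.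
Context (k : fieldType) (Z : choiceType).
Local Notation kZ := {malg k[bword Z]}.

Lemma bword_evalM (A : uOpAlgType k) (h : Z -> A) (u v : bword Z) :
  bword_eval h (mmul u v) = bword_eval h u * bword_eval h v.
Proof.
rewrite /bword_eval fmM; elim: (u : seq _) => [|a s IH] /=.
  by rewrite mul1r.
by rewrite IH mulrA.
Qed.

Lemma bword_eval_brack (A : uOpAlgType k) (h : Z -> A) (u : bword Z) :
  bword_eval h (brack u) = oper (bword_eval h u).
Proof. by rewrite /bword_eval /= mulr1. Qed.

Lemma bword_eval_atom (A : uOpAlgType k) (h : Z -> A) z :
  bword_eval h (atom z) = h z.
Proof. by rewrite /bword_eval /= mulr1. Qed.

Lemma malg_evalU (A : uOpAlgType k) (h : Z -> A) u :
  malg_eval h << u >> = bword_eval h u.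
Proof. exact: linextU. Qed.

Lemma malg_eval_hom (A : uOpAlgType k) (h : Z -> A) : opalg_hom (malg_eval h).
Proof.
have linh : lin (malg_eval h) by apply: lin_linext.
split; [split; try by case: linh|].
- move=> f g; move: f; apply: (lin_eq (f := fun f => malg_eval h (f * g)))
      => [||u].
  + exact: lin_comp (lin_mulr g) linh.
  + exact: lin_comp linh (lin_mulr _).
  move: g; apply: (lin_eq (f := fun g => malg_eval h (<< u >> * g))) => [||v].
  + exact: lin_comp (lin_mull _) linh.
  + exact: lin_comp linh (lin_mull _).
  by rewrite malgUM !malg_evalU bword_evalM.
- by rewrite malg_evalU /bword_eval fm1.
- apply: (lin_eq (f := malg_eval h \o @oper k kZ)) => [||u].
  + exact: lin_comp (@lin_oper k _) linh.
  + exact: lin_comp linh (@lin_oper k _).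
  by rewrite /= operU !malg_evalU bword_eval_brack.
Qed.

Lemma bword_consE (a : bletter Z) s :
  FMonom (a :: s) = mmul (FMonom [:: a]) (FMonom s).
Proof. by rewrite -[mmul _ _]/(fmmul _ _) fmmulE. Qed.

Lemma opalg_hom_eq (B : uOpAlgType k) (f g : kZ -> B) :
  opalg_hom f -> opalg_hom g ->
  (forall z, f << atom z >> = g << atom z >>) -> f =1 g.
Proof.
move=> [[fD fZ fM f1] fo] [[gD gZ gM g1] go] fg.
apply: lin_eq => // -[s]; elim/forest_ind: s => [|z s IH|t s IHt IHs].
- by rewrite -fmoneE f1 g1.
- by rewrite bword_consE -malgUM fM gM IH (fg z).
- rewrite bword_consE -malgUM fM gM IHs -[FMonom [:: _]]/(brack (FMonom t)).
  by rewrite -operU fo go IHt.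
Qed.

Lemma opalg_hom_comp (A B C : uOpAlgType k) (f : A -> B) (g : B -> C) :
  opalg_hom f -> opalg_hom g -> opalg_hom (g \o f).
Proof.
move=> [[fD fZ fM f1] fo] [[gD gZ gM g1] go].
by split; [split=> [x y|c x|x y|]|move=> x] => /=;
  rewrite ?fD ?gD ?fZ ?gZ ?fM ?gM ?f1 ?g1 ?fo ?go.
Qed.

Lemma hom_malg_eval (A B : uOpAlgType k) (g : A -> B) (h : Z -> A) f :
  opalg_hom g -> g (malg_eval h f) = malg_eval (g \o h) f.
Proof.
move=> ghom; apply: (opalg_hom_eq (f := g \o malg_eval h)) => [||z].
- exact: opalg_hom_comp (malg_eval_hom _) ghom.
- exact: malg_eval_hom.
- by rewrite /= !malg_evalU !bword_eval_atom.
Qed.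

End Evaluation.

Lemma hom_opi_at (k : fieldType) (A B : uOpAlgType k) (g : A -> B)
    (phi : opi k) r s :
  opalg_hom g -> g (opi_at phi r s) = opi_at phi (g r) (g s).
Proof.
move=> ghom; rewrite /opi_at hom_malg_eval //; congr (malg_eval _ phi).
by apply/funext => -[].
Qed.

Section AssociativeEmbedding.
Context (k : fieldType) (Z : choiceType).
Local Notation kM := {malg k[{fmonom Z}]}.
Local Notation kZ := {malg k[bword Z]}.

Lemma malg_inclE : @malg_incl k Z = mapw (@word_incl Z).
Proof. by []. Qed.

Lemma word_incl_mul (u v : {fmonom Z}) :
  word_incl (mmul u v) = mmul (word_incl u) (word_incl v).
Proof.
by apply/eqP; rewrite fmP fmM /= /word_incl fmM map_cat.
Qed.

Lemma malg_incl_hom : alg_hom (@malg_incl k Z).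
Proof.
rewrite malg_inclE; case: (lin_mapw (k := k) (@word_incl Z)) => FD FZ.
split=> //; last first.
  transitivity (<< word_incl (mone : {fmonom Z}) >> : kZ); first exact: mapwU.
  suff -> : word_incl (mone : {fmonom Z}) = mone by [].
  by apply/eqP; rewrite fmP /word_incl !fm1.
move=> f g; move: f; apply: (lin_eq (f := fun f => mapw _ (f * g))) => [||u].
- exact: lin_comp (lin_mulr g) (lin_mapw _).
- exact: lin_comp (lin_mapw _) (lin_mulr _).
move: g; apply: (lin_eq (f := fun g => mapw _ (<< u >> * g))) => [||v].
- exact: lin_comp (lin_mull _) (lin_mapw _).
- exact: lin_comp (lin_mapw _) (lin_mull _).
by rewrite malgUM !mapwU malgUM word_incl_mul.
Qed.

Lemma malg_alg_hom_eq (B : uAlgType k) (f g : kM -> B) :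
  alg_hom f -> alg_hom g ->
  (forall z, f << fmu z >> = g << fmu z >>) -> f =1 g.
Proof.
move=> [fD fZ fM f1] [gD gZ gM g1] fg.
apply: lin_eq => // -[]; elim=> [|z s IH]; first by rewrite -fmoneE f1 g1.
have -> : FMonom (z :: s) = mmul (fmu z) (FMonom s).
  by rewrite -[mmul _ _]/(fmmul _ _) fmmulE fmU.
by rewrite -malgUM fM gM IH fg.
Qed.

End AssociativeEmbedding.

(** * Multilinear identities *)

Section Multilinear.
Context (k : fieldType) (Z : choiceType) (A : uOpAlgType k).
Context (z : Z) (h : A -> Z -> A).
Hypotheses (hz : forall r, h r z = r).
Hypotheses (h_off : forall r r' x, x != z -> h r x = h r' x).

Lemma eval_occ0 (u : bword Z) r r' :
  occ (pred1 z) u = 0%N -> bword_eval (h r) u = bword_eval (h r') u.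
Proof.
case: u => s; rewrite /occ /bword_eval /=.
elim/forest_ind: s => [|x s IH|t s IHt IHs] //=.
  by have [_ //|xz /IH ->] := eqVneq x z; rewrite (h_off r r').
by move/eqP; rewrite addn_eq0 => /andP[/eqP/IHt-> /eqP/IHs->].
Qed.

Lemma eval_occ1 (u : bword Z) :
  occ (pred1 z) u = 1%N -> lin (fun r => bword_eval (h r) u).
Proof.
have lin_ext (f g : A -> A) : f =1 g -> lin f -> lin g.
  by move=> fg [fD fZ]; split=> [x y|c x]; rewrite -!fg ?fD ?fZ.
case: u => s; rewrite /occ /bword_eval /=.
elim/forest_ind: s => [|x s IH|t s IHt IHs] //=.
  have [-> /= /eqP|xz] := eqVneq x z.
    rewrite eqSS => /eqP s0; apply: lin_ext (lin_mulr (bword_eval (h 0) (FMonom s))).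
    by move=> r /=; rewrite hz (@eval_occ0 (FMonom s) 0 r).
  rewrite add0n => /IH linS; apply: lin_ext (lin_comp linS (lin_mull (h 0 x))).
  by move=> r /=; rewrite (h_off r 0).
case t1 : (sumn (map (bletter_occ _) t)) => [|[|//]] /eqP.
  rewrite add0n => /eqP/IHs linS.
  apply: lin_ext (lin_comp linS
    (lin_mull (oper (bword_eval (h 0) (FMonom t))))) => r /=.
  by rewrite (@eval_occ0 (FMonom t) 0 r).
rewrite eqSS => /eqP s0.
apply: lin_ext (lin_comp (lin_comp (IHt t1) (@lin_oper k A))
    (lin_mulr (bword_eval (h 0) (FMonom s)))) => r /=.
by rewrite (@eval_occ0 (FMonom s) 0 r).
Qed.

(** This places the lower part of the identity, evaluated where a relation has
    been plugged into one variable, in the operated ideal of that relation. *)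
Lemma eval_ideal (J : opideal A) (u : bword Z) r :
  occ (pred1 z) u != 0%N -> J r -> J (bword_eval (h r) u).
Proof.
move=> uz Jr; case: u uz => s; rewrite /occ /bword_eval /=.
elim/forest_ind: s => [|x s IH|t s IHt IHs] //=.
  have [-> _|_ /IH Js] := eqVneq x z.
    by rewrite hz; exact: Defs.idealMr.
  exact: Defs.idealMl.
by rewrite addn_eq0 negb_and => /orP[/IHt Jt|/IHs Js];
  [apply/Defs.idealMr/opideal_oper|apply: Defs.idealMl].
Qed.

Context (f : {malg k[bword Z]}).
Hypothesis f_z : forall u, u \in msupp f -> occ (pred1 z) u = 1%N.

Lemma malg_eval_lin : lin (fun r => malg_eval (h r) f).
Proof.
have Qf u : f@_u != 0 -> occ (pred1 z) u = 1%N by rewrite mcoeff_neq0 => /f_z.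
move: Qf; move: (f); apply: malg_ind => [|c u g u1 [gD gZ]].
  split=> [x y|c x]; rewrite /malg_eval !(lin0 (lin_linext _)) ?addr0 //.
  by rewrite uscaler0.
have hlin x := lin_linext (k := k) (bword_eval (h x)).
have [hD hZ] := (fun x => proj1 (hlin x), fun x => proj2 (hlin x)).
have [uD uZ] := eval_occ1 u1.
split=> [x y|d x] /=; rewrite /malg_eval !hD -![_ *: _]/(uscale _ _) !hZ.
  by rewrite !linextU uD [linext _ g]gD uscaleDr addrACA.
rewrite !linextU uZ [linext _ g]gZ uscaleDr !uscaleA.
by rewrite mulrC.
Qed.

Lemma malg_eval_ideal (J : opideal A) r : J r -> J (malg_eval (h r) f).
Proof.
have Qf u : f@_u != 0 -> occ (pred1 z) u = 1%N by rewrite mcoeff_neq0 => /f_z.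
move=> Jr; move: Qf; move: (f); apply: malg_ind => [|c u g u1 Jg].
  by rewrite /malg_eval (lin0 (lin_linext _)); apply: ideal0.
have [hD hZ] := lin_linext (k := k) (bword_eval (h r)).
rewrite /malg_eval hD -[_ *: _]/(uscale _ _) hZ linextU uscale_is_mul.
by apply: idealD => //; apply/Defs.idealMl/eval_ideal; rewrite ?u1.
Qed.

End Multilinear.

Definition bilinear_opi (k : fieldType) (B : opi k) : Prop :=
  forall m, m \in msupp B ->
    occ (pred1 true) m = 1%N /\ occ (pred1 false) m = 1%N.

Section Bilinear.
Context (k : fieldType) (A : uOpAlgType k) (B : opi k).
Hypothesis B_lin : bilinear_opi B.

Lemma opi_at_linl (s : A) : lin (fun r => opi_at B r s).
Proof.
by apply: (malg_eval_lin (z := true)) => [//|r r' []|u /B_lin[]].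
Qed.

Lemma opi_at_linr (r : A) : lin (fun s => opi_at B r s).
Proof.
by apply: (malg_eval_lin (z := false)) => [//|s s' []|u /B_lin[]].
Qed.

Lemma opi_at_ideall (J : opideal A) r s : J r -> J (opi_at B r s).
Proof.
by apply: (malg_eval_ideal (z := true) (h := fun r b => if b then r else s))
  => [//|u /B_lin[]].
Qed.

Lemma opi_at_idealr (J : opideal A) r s : J s -> J (opi_at B r s).
Proof.
by apply: (malg_eval_ideal (z := false) (h := fun s b => if b then r else s))
  => [//|u /B_lin[]].
Qed.

Lemma opi_at_rota_baxter (r s : A) :
  opi_at (oper (@opi_x k) * oper (@opi_y k) - oper B) r s =
  oper r * oper s - oper (opi_at B r s).
Proof.
rewrite /opi_at; set h := fun b : bool => _.
have [[hD hZ hM _] ho] := malg_eval_hom h.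
have hB := linB _ _ (alg_hom_lin (malg_eval_hom h).1).
rewrite [LHS]hB; congr (_ - _); last exact: ho.
rewrite [LHS]hM; congr (_ * _); rewrite [LHS]ho; congr oper.
  by rewrite malg_evalU bword_eval_atom.
by rewrite malg_evalU bword_eval_atom.
Qed.

Let phi := oper (@opi_x k) * oper (@opi_y k) - oper B.

Lemma rota_baxter_linl (s : A) : lin (fun r => opi_at phi r s).
Proof.
have [BD BZ] := opi_at_linl s.
split=> [x y|c x]; rewrite !opi_at_rota_baxter.
  by rewrite BD !operD mulrDl opprD addrACA.
by rewrite BZ !operZ -uscaleAl uscaleDr -!uscaleN1 !uscaleA mulrC.
Qed.

Lemma rota_baxter_linr (r : A) : lin (fun s => opi_at phi r s).
Proof.
have [BD BZ] := opi_at_linr r.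
split=> [x y|c x]; rewrite !opi_at_rota_baxter.
  by rewrite BD !operD mulrDr opprD addrACA.
by rewrite BZ !operZ -uscaleAr uscaleDr -!uscaleN1 !uscaleA mulrC.
Qed.

End Bilinear.

(** * The free algebra over a presented algebra *)

Section QuotientMaps.
Context (k : fieldType).

Lemma to_quotient_hom (A : uAlgType k) (I : ideal A) :
  alg_hom (to_quotient I : A -> quotient I).
Proof.
split=> [x y|c x|x y|]; last by [].
- exact: to_quotientD.
- exact: to_quotientZ.
- exact: to_quotientM.
Qed.

Lemma to_op_quotient_hom (A : uOpAlgType k) (J : opideal A) :
  opalg_hom (to_op_quotient J : A -> op_quotient J).
Proof.
split; last exact: to_op_quotient_oper.
split=> [x y|c x|x y|]; last by [].
- exact: to_quotientD.
- exact: to_quotientZ.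
- exact: to_quotientM.
Qed.

Lemma to_quotient_eq0 (A : uAlgType k) (I : ideal A) (x : A) :
  I x -> to_quotient I x = 0.
Proof.
move=> Ix; rewrite -(lin0 (alg_hom_lin (to_quotient_hom I))).
by apply/to_quotientP; rewrite subr0.
Qed.

(** The representative of a class is determined up to the ideal, which [f] does
    not see; hence [f \o repr] is the map induced on the quotient. *)
Lemma quotient_lift (A B : uAlgType k) (I : ideal A) (f : A -> B) :
  alg_hom f -> (forall x, I x -> f x = 0) ->
  forall x, f (repr (to_quotient I x)) = f x.
Proof.
move=> fhom fI x; apply/eqP; rewrite -subr_eq0.
rewrite -(linB _ _ (alg_hom_lin fhom)); apply/eqP/fI.
exact: repr_to_quotient.
Qed.

Lemma quotient_lift_hom (A B : uAlgType k) (I : ideal A) (f : A -> B) :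
  alg_hom f -> (forall x, I x -> f x = 0) ->
  alg_hom (fun a : quotient I => f (repr a)).
Proof.
move=> fhom fI; have lift := quotient_lift fhom fI.
case: (to_quotient_hom I) => piD piZ piM pi1.
case: (fhom) => fD fZ fM f1; split=> [a b|c a|a b|].
- case: (to_quotient_surj a) (to_quotient_surj b) => x <- [y <-].
  by rewrite -piD !lift fD.
- by case: (to_quotient_surj a) => x <-; rewrite -piZ !lift fZ.
- case: (to_quotient_surj a) (to_quotient_surj b) => x <- [y <-].
  by rewrite -piM !lift fM.
- by rewrite -pi1 lift f1.
Qed.

Lemma op_quotient_lift_hom (A B : uOpAlgType k) (J : opideal A) (f : A -> B) :
  opalg_hom f -> (forall x, J x -> f x = 0) ->
  opalg_hom (fun a : op_quotient J => f (repr a)).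
Proof.
move=> [fhom fo] fJ; split; first exact: quotient_lift_hom.
have lift := quotient_lift fhom fJ.
move=> a; case: (to_quotient_surj a) => x <-.
rewrite -[to_quotient J x]/(to_op_quotient J x).
by rewrite -[oper _]to_op_quotient_oper !lift fo.
Qed.

Lemma gen_opideal_sub (A : uOpAlgType k) (S : set A) (J : opideal A) :
  S `<=` ideal_set J -> ideal_set (gen_opideal S) `<=` ideal_set J.
Proof. by move=> SJ x; apply. Qed.

Lemma sub_gen_opideal (A : uOpAlgType k) (S : set A) :
  S `<=` ideal_set (gen_opideal S).
Proof. by move=> x Sx J; apply. Qed.

Lemma idealZ (A : uAlgType k) (I : ideal A) (c : k) x : I x -> I (uscale c x).
Proof. by move=> Ix; rewrite uscale_is_mul; apply: Defs.idealMl. Qed.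

Lemma lin_ideal (M : monomType) (A : uAlgType k) (I : ideal A)
    (L : {malg k[M]} -> A) :
  lin L -> (forall m, I (L << m >>)) -> forall f, I (L f).
Proof.
move=> linL IL f; have [LD LZ] := linL.
apply: (malg_ind (Q := fun=> True) (P := fun f => I (L f))) => [|c m g _ Ig|//].
  by rewrite (lin0 linL); apply: ideal0.
by rewrite LD; apply: idealD Ig; rewrite [L _]LZ; apply: idealZ.
Qed.

Section Kernel.
Context (A B : uOpAlgType k) (f : A -> B).
Hypothesis fhom : opalg_hom f.

Fact kernel0 : f 0 = 0.
Proof. exact/lin0/alg_hom_lin/fhom.1. Qed.

Fact kernelD x y : f x = 0 -> f y = 0 -> f (x + y) = 0.
Proof. by case: fhom => -[fD _ _ _] _ fx fy; rewrite fD fx fy addr0. Qed.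

Fact kernelMl a x : f x = 0 -> f (a * x) = 0.
Proof. by case: fhom => -[_ _ fM _] _ fx; rewrite fM fx mulr0. Qed.

Fact kernelMr a x : f x = 0 -> f (x * a) = 0.
Proof. by case: fhom => -[_ _ fM _] _ fx; rewrite fM fx mul0r. Qed.

Fact kernel_oper x : f x = 0 -> f (oper x) = 0.
Proof. by case: fhom => _ fo fx; rewrite fo fx (lin0 (lin_oper _)). Qed.

Definition kernel : opideal A :=
  @OpIdeal k A (Ideal kernel0 kernelD kernelMl kernelMr) kernel_oper.

End Kernel.

Lemma hom_gen_ideal (A B : uAlgType k) (f : A -> B) (S : set A) (K : ideal B) :
  alg_hom f -> (forall x, S x -> K (f x)) -> forall x, gen_ideal S x -> K (f x).
Proof.
move=> fhom SK x Sx; have f0 := lin0 (alg_hom_lin fhom).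
case: fhom => fD _ fM _.
have P0 : K (f 0) by rewrite f0; apply: ideal0.
have PD y z : K (f y) -> K (f z) -> K (f (y + z)).
  by move=> Ky Kz; rewrite fD; apply: idealD.
have PMl a y : K (f y) -> K (f (a * y)).
  by move=> Ky; rewrite fM; apply: Defs.idealMl.
have PMr a y : K (f y) -> K (f (y * a)).
  by move=> Ky; rewrite fM; apply: Defs.idealMr.
exact: (Sx (@Ideal A (fun y => K (f y)) P0 PD PMl PMr)).
Qed.

End QuotientMaps.

Section FreeAlgebra.
Context (k : fieldType) (Z : choiceType).
Local Notation kM := {malg k[{fmonom Z}]}.
Local Notation kZ := {malg k[bword Z]}.
Context (I : ideal kM) (phi : opi k).

Let J : opideal kZ :=
  gen_opideal (@S_opi k phi Z `|` [set malg_incl f | f in ideal_set I]).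

(** The generators contain the values of [phi] at monomials only; linearity in
    each variable extends the vanishing to arbitrary elements. *)
Lemma quotient_phi_algebra :
  (forall (A : uOpAlgType k) (s : A), lin (fun r => opi_at phi r s)) ->
  (forall (A : uOpAlgType k) (r : A), lin (fun s => opi_at phi r s)) ->
  phi_algebra phi (op_quotient J).
Proof.
move=> linl linr r s.
have pihom := to_op_quotient_hom J.
case: (to_quotient_surj r) (to_quotient_surj s) => f <- [g <-].
rewrite -!/(to_op_quotient J _) -hom_opi_at //.
apply: to_quotient_eq0.
apply: (lin_ideal (linl _ _)) => u; apply: (lin_ideal (linr _ _)) => v.
by apply: sub_gen_opideal; left; exists u, v.
Qed.

(** A homomorphism [f] from the presented algebra is determined by the images
    of the letters, which extend to an operated homomorphism [e] on bracketed
    polynomials.  Now [e] kills [I] because it agrees with [f] on associative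
    polynomials, and it kills the values of [phi] because the target is a
    [phi]-algebra. *)
Lemma presented_free_phi_algebra :
  phi_algebra phi (op_quotient J) ->
  exists2 i : quotient I -> op_quotient J,
    forall f, i (to_quotient I f) = to_op_quotient J (malg_incl f) &
    is_free_phi_algebra phi i.
Proof.
move=> phiJ; have pihom := to_op_quotient_hom J.
have incl_hom : alg_hom (to_op_quotient J \o @malg_incl k Z).
  case: (pihom) (malg_incl_hom k Z) => -[pD pZ pM p1] _ [iD iZ iM i1].
  by split=> [x y|c x|x y|] /=; rewrite ?iD ?iZ ?iM ?i1 ?pD ?pZ ?pM ?p1.
have incl0 f : I f -> to_op_quotient J (malg_incl f) = 0.
  by move=> If; apply: to_quotient_eq0; apply: sub_gen_opideal; right; exists f.
pose i (a : quotient I) : op_quotient J := to_op_quotient J (malg_incl (repr a)).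
have iE f : i (to_quotient I f) = to_op_quotient J (malg_incl f).
  exact: (quotient_lift incl_hom incl0).
exists i; first exact: iE.
split; [exact: phiJ|exact: (quotient_lift_hom incl_hom incl0)|].
move=> B f phiB fhom.
have fpihom : alg_hom (f \o to_quotient I).
  case: fhom (to_quotient_hom I) => fD fZ fM f1 [pD pZ pM p1].
  by split=> [x y|c x|x y|] /=; rewrite ?pD ?pZ ?pM ?p1 ?fD ?fZ ?fM ?f1.
pose e := malg_eval (fun z => f (to_quotient I << fmu z >>)).
have ehom : opalg_hom e := malg_eval_hom _.
have word_incl_fmu z : word_incl (fmu z) = atom z :> bword Z.
  by apply/eqP; rewrite fmP /word_incl fmU.
have eincl x : e (malg_incl x) = f (to_quotient I x).
  apply: (malg_alg_hom_eq (f := e \o @malg_incl k Z)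
                          (g := f \o to_quotient I)) => [|//|z].
    case: ehom (malg_incl_hom k Z) => -[eD eZ eM e1] _ [iD iZ iM i1].
    by split=> [u v|c u|u v|] /=; rewrite ?iD ?iZ ?iM ?i1 ?eD ?eZ ?eM ?e1.
  by rewrite /= malg_inclE mapwU word_incl_fmu [LHS]malg_evalU bword_eval_atom.
have eJ x : J x -> e x = 0.
  apply: (@gen_opideal_sub _ _ _ (kernel ehom)) => _ [[u [v ->]]|[y Iy <-]] /=.
    by rewrite hom_opi_at.
  rewrite eincl -[RHS](lin0 (alg_hom_lin fhom)); congr f.
  exact: to_quotient_eq0.
have elift := quotient_lift ehom.1 eJ.
exists (fun a => e (repr a)); split=> [|h [hhom hi]].
  split; first exact: op_quotient_lift_hom.
  apply/funext => a; case: (to_quotient_surj a) => x <- /=.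
  by rewrite iE [LHS]elift eincl.
apply/funext => a; case: (to_quotient_surj a) => x <-.
rewrite [LHS]elift; symmetry; move: x.
apply: (opalg_hom_eq (f := h \o to_op_quotient J)) => [||z].
- exact: opalg_hom_comp pihom hhom.
- exact: ehom.
rewrite [RHS]malg_evalU bword_eval_atom -hi /= iE malg_inclE mapwU.
by rewrite word_incl_fmu.
Qed.

End FreeAlgebra.

(** * Leading monomials *)

Definition total_order (T : Type) (le : T -> T -> Prop) : Prop :=
  [/\ forall x y, le x y \/ le y x,
      forall x y, le x y -> le y x -> x = y &
      forall x y z, le x y -> le y z -> le x z].

Lemma well_order_total (T : Type) (le : T -> T -> Prop) :
  well_order le -> total_order le.
Proof. by case. Qed.

Section TotalOrder.
Context (T : Type) (le : T -> T -> Prop).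
Hypothesis le_total : total_order le.

Lemma le_refl x : le x x.
Proof. by case: le_total => /(_ x x)[]. Qed.

Lemma le_lt_trans x y z : le x y -> strict le y z -> strict le x z.
Proof.
case: le_total => _ asym trans lexy [leyz neyz]; split; first exact: trans leyz.
by move=> exz; apply: neyz; apply: asym => //; rewrite -exz.
Qed.

Lemma lt_le_trans x y z : strict le x y -> le y z -> strict le x z.
Proof.
case: le_total => _ asym trans [lexy nexy] leyz; split; first exact: trans leyz.
by move=> exz; apply: nexy; apply: asym => //; rewrite exz.
Qed.

Lemma lt_irrefl x : ~ strict le x x.
Proof. by case. Qed.

Lemma le_or_lt x y : le x y \/ strict le y x.
Proof.
case: le_total => tot _ _; case: (tot x y) => [|leyx]; first by left.
have [->|neyx] := pselect (y = x); first by left; apply: le_refl.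
by right.
Qed.

Lemma strict_mono_inj (U : Type) (leU : U -> U -> Prop) (F : T -> U) :
  (forall u v, strict le u v -> strict leU (F u) (F v)) -> injective F.
Proof.
move=> Fmono x y eF; apply: contrapT => nexy.
case: (le_or_lt x y) => [lexy|/Fmono[_]]; last by rewrite eF.
by case: (Fmono x y) => //; rewrite eF.
Qed.

End TotalOrder.

Section Leading.
Context (k : fieldType) (T : choiceType) (le : {fmonom T} -> {fmonom T} -> Prop).
Hypothesis le_total : total_order le.
Local Notation kT := {malg k[{fmonom T}]}.
Local Notation lead := (lead le).

Lemma leadP (f : kT) : f != 0 ->
  f@_(lead f) != 0 /\ forall m, f@_m != 0 -> le m (lead f).
Proof.
move=> f0; have [tot asym trans] := le_total.
have ex_max (s : seq {fmonom T}) : s != [::] ->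
    exists m, m \in s /\ forall m', m' \in s -> le m' m.
  elim: s => // x s IH _; have [->|/IH[m [ms maxm]]] := eqVneq s [::].
    by exists x; rewrite inE; split=> // m'; rewrite inE => /eqP->; apply: le_refl.
  case: (tot x m) => [lexm|lemx].
    exists m; rewrite inE ms orbT; split=> // m'.
    by rewrite inE => /orP[/eqP->|/maxm].
  exists x; rewrite inE eqxx; split=> // m'; rewrite inE.
  by case/orP=> [/eqP->|/maxm lem'm]; [apply: le_refl|apply: trans lemx].
have [|m [mf maxm]] := ex_max (msupp f).
  apply: contraNneq f0 => f0; rewrite -msupp_eq0; apply/eqP/fsetP => m.
  by rewrite inE -[_ \in msupp f]/(m \in (msupp f : seq _)) f0.
have [] := @xgetPex _ mone
  [set m | m \in msupp f /\ forall m', m' \in msupp f -> le m' m].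
  by exists m.
rewrite -/(lead f) => leadf max_lead; rewrite mcoeff_neq0; split=> // m'.
by rewrite mcoeff_neq0 => /max_lead.
Qed.

Lemma lead_neq0 (f : kT) : f != 0 -> f@_(lead f) != 0.
Proof. by case/leadP. Qed.

Lemma lead_max (f : kT) m : f@_m != 0 -> le m (lead f).
Proof.
have [->|/leadP[_ maxf]] := eqVneq f 0; last exact: maxf.
by rewrite mcoeff0 eqxx.
Qed.

Lemma lead_eq (f : kT) m :
  f@_m != 0 -> (forall m', f@_m' != 0 -> le m' m) -> lead f = m.
Proof.
move=> fm maxm; case: le_total => _ asym _; apply: asym; last exact: lead_max.
apply: maxm; apply: lead_neq0.
by apply: contraNneq fm => ->; rewrite mcoeff0.
Qed.

Lemma lead0 : lead (0 : kT) = mone.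
Proof.
apply: xgetPN => m [].
by rewrite -mcoeff_neq0 mcoeff0 eqxx.
Qed.

Lemma mcoeff_monicize (f : kT) : f != 0 -> (monicize le f)@_(lead f) = 1.
Proof. by move=> f0; rewrite mcoeffZ mulVf // lead_neq0. Qed.

Lemma monicizeK (f : kT) : f@_(lead f) *: monicize le f = f.
Proof.
have [->|f0] := eqVneq f 0; first by rewrite mcoeff0 scale0r.
by rewrite scalerA divff ?scale1r // lead_neq0.
Qed.

Lemma monicize_monic (f : kT) : f@_(lead f) = 1 -> monicize le f = f.
Proof. by rewrite /monicize => ->; rewrite invr1 scale1r. Qed.

Lemma monicize_supp (f : kT) m : (monicize le f)@_m != 0 -> le m (lead f).
Proof.
rewrite mcoeffZ => fm; apply: lead_max; apply: contraNneq fm => ->.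
by rewrite mulr0.
Qed.

Lemma monic_tail (f : kT) m : f != 0 ->
  (monicize le f - << lead f >>)@_m != 0 -> strict le m (lead f).
Proof.
move=> f0; rewrite mcoeffB mcoeffU1.
have [<-|ne] := eqVneq (lead f) m; first by rewrite mcoeff_monicize // subrr eqxx.
by rewrite subr0 => /monicize_supp; split=> //; apply/eqP; rewrite eq_sym.
Qed.

End Leading.

Section LeadingMap.
Context (k : fieldType) (T U : choiceType).
Context (le : {fmonom T} -> {fmonom T} -> Prop).
Context (leU : {fmonom U} -> {fmonom U} -> Prop).
Hypotheses (le_total : total_order le) (leU_total : total_order leU).
Context (F : {fmonom T} -> {fmonom U}).
Hypothesis F_mono : forall u v, strict le u v -> strict leU (F u) (F v).

Lemma mapw_supp (f : {malg k[{fmonom T}]}) n :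
  (mapw F f)@_n != 0 -> exists2 m, f@_m != 0 & n = F m.
Proof.
move=> fn; apply: contrapT => nex; case/eqP: fn; apply: mcoeff_mapw_eq0.
by move=> m fm Fm; apply: nex; exists m.
Qed.

Lemma mono_le u v : le u v -> leU (F u) (F v).
Proof.
have [->|ne] := pselect (u = v); first by move=> _; apply: le_refl.
by move=> leuv; case: (@F_mono u v).
Qed.

Lemma lead_mapw (f : {malg k[{fmonom T}]}) :
  f != 0 -> lead leU (mapw F f) = F (lead le f).
Proof.
move=> f0; apply: lead_eq => //.
  by rewrite mcoeff_mapw ?lead_neq0 //; apply: strict_mono_inj F_mono.
by move=> n /mapw_supp[m fm ->]; apply: mono_le; apply: lead_max.
Qed.

Lemma monicize_mapw (f : {malg k[{fmonom T}]}) :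
  f != 0 -> monicize leU (mapw F f) = mapw F (monicize le f).
Proof.
move=> f0; rewrite /monicize lead_mapw // mcoeff_mapw ?mapwZ //.
exact: strict_mono_inj F_mono.
Qed.

End LeadingMap.

(** * Representations with bounded leading monomials *)

Lemma sum_ord_cons (V : zmodType) n (x : V) (F : 'I_n.+1 -> V) (F' : 'I_n -> V) :
  F ord0 = x -> (forall i, F (lift ord0 i) = F' i) ->
  \sum_(i < n.+1) F i = x + \sum_(i < n) F' i.
Proof. by move=> <- FF; rewrite big_ord_recl; under eq_bigr do rewrite FF. Qed.

Section Span.
Context (k : fieldType) (T : choiceType) (le : {fmonom T} -> {fmonom T} -> Prop).
Context (C : Type) (plug : C -> {fmonom T} -> {fmonom T}).
Local Notation kT := {malg k[{fmonom T}]}.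
Local Notation lead := (lead le).
Implicit Types (G : set kT) (P : {fmonom T} -> Prop) (f g h s : kT).

(** Triviality modulo [(G, w)] is the case where [P] bounds strictly by [w];
    other bounds occur when a bound is lowered step by step. *)
Inductive bspan G P : kT -> Prop :=
| bspan0 : bspan G P 0
| bspan_cons c q s h of G s & P (plug q (lead s)) & bspan G P h :
    bspan G P (c *: mapw (plug q) s + h).

Lemma bspanD G P f g : bspan G P f -> bspan G P g -> bspan G P (f + g).
Proof.
elim=> [|c q s h Gs Pq _ IH] Sg; first by rewrite add0r.
by rewrite -addrA; apply: bspan_cons => //; apply: IH.
Qed.

Lemma bspanZ G P c f : bspan G P f -> bspan G P (c *: f).
Proof.
elim=> [|d q s h Gs Pq _ IH]; first by rewrite scaler0; apply: bspan0.
by rewrite scalerDr scalerA; apply: bspan_cons.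
Qed.

Lemma bspanN G P f : bspan G P f -> bspan G P (- f).
Proof. by rewrite -scaleN1r; apply: bspanZ. Qed.

Lemma bspanB G P f g : bspan G P f -> bspan G P g -> bspan G P (f - g).
Proof. by move=> Sf Sg; apply: bspanD => //; apply: bspanN. Qed.

Lemma bspan_gen G P q s : G s -> P (plug q (lead s)) -> bspan G P (mapw (plug q) s).
Proof.
move=> Gs Pq; rewrite -[mapw _ _]scale1r -[_ *: _]addr0.
by apply: bspan_cons => //; apply: bspan0.
Qed.

Lemma bspan_sub G G' P P' f :
  G `<=` G' -> (forall w, P w -> P' w) -> bspan G P f -> bspan G' P' f.
Proof.
move=> GG PP; elim=> [|c q s h Gs Pq _ IH]; first exact: bspan0.
by apply: bspan_cons => //; [apply: GG|apply: PP].
Qed.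

Lemma trivial_modP G w h :
  trivial_mod le plug G w h <-> bspan G (fun m => strict le m w) h.
Proof.
split=> [[n [c [q [s [Gs ->]]]]]|].
  apply: (big_ind (bspan G (fun m => strict le m w))).
  - exact: bspan0.
  - by move=> *; apply: bspanD.
  - by move=> i _; case: (Gs i) => Gsi Pi; apply/bspanZ/bspan_gen.
elim=> [|c q s h' Gs Pq _ [n [c' [q' [s' [Gs' ->]]]]]].
  have none (X : Type) (i : 'I_0) : X by case: i.
  by exists 0%N, (none k), (none C), (none kT); split=> [[]//|]; rewrite big_ord0.
pose cons_ord (X : Type) (x : X) (xs : 'I_n -> X) (i : 'I_n.+1) :=
  oapp xs x (unlift ord0 i).
exists n.+1, (cons_ord _ c c'), (cons_ord _ q q'), (cons_ord _ s s'); split.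
  by move=> i; rewrite /cons_ord; case: unliftP => [j _|_] /=.
symmetry; apply: sum_ord_cons => [|i].
  by rewrite /cons_ord unlift_none.
by rewrite /cons_ord liftK.
Qed.

End Span.

(** * The composition lemma *)

Section CompositionLemma.
Context (k : fieldType) (T : choiceType) (le : {fmonom T} -> {fmonom T} -> Prop).
Context (C : Type) (plug : C -> {fmonom T} -> {fmonom T}).
Local Notation kT := {malg k[{fmonom T}]}.
Local Notation lead := (lead le).
Local Notation bspan := (bspan le plug).
Implicit Types (f g h s : kT).

Context (G : set kT).
Hypothesis le_wf : well_order le.
Hypothesis plug_mono :
  forall q u v, strict le u v -> strict le (plug q u) (plug q v).

Let le_total : total_order le := well_order_total le_wf.

(** Two occurrences of leading monomials in one monomial give two reductions of
    it, whose difference has to be represented below that monomial. *)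
Hypothesis G_confluent : forall s1 s2 q1 q2,
  G s1 -> G s2 -> s1 != 0 -> s2 != 0 ->
  plug q1 (lead s1) = plug q2 (lead s2) ->
  bspan G (fun m => strict le m (plug q1 (lead s1)))
    (mapw (plug q1) (monicize le s1) - mapw (plug q2) (monicize le s2)).

(** All terms of maximal leading monomial can be moved to a single one, whose
    coefficient is then the coefficient of that monomial in the sum. *)
Lemma bspan_lower w f :
  bspan G (fun m => le m w) f -> f@_w = 0 -> bspan G (fun m => strict le m w) f.
Proof.
have [[q0 [s0 [Gs0 s00 w_def]]]|notop] := pselect (exists q0 s0,
  [/\ G s0, s0 != 0 & plug q0 (lead s0) = w]); last first.
  move=> Sf _; elim: Sf => [|c q s h Gs Pq _ IH]; first exact: bspan0.
  have [->|s0] := eqVneq s 0; first by rewrite mapw0 scaler0 add0r.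
  apply: bspan_cons => //; split=> // ew.
  by apply: notop; exists q, s.
pose top := mapw (plug q0) (monicize le s0).
suff key : bspan G (fun m => le m w) f ->
    bspan G (fun m => strict le m w) (f - f@_w *: top).
  by move=> /key + fw; rewrite fw scale0r subr0.
elim=> [|c q s h Gs Pq _ IH]; first by rewrite mcoeff0 scale0r subr0; apply: bspan0.
rewrite mcoeffD scalerDl opprD addrACA; apply: bspanD IH.
have [->|sn0] := eqVneq s 0.
  by rewrite mapw0 scaler0 mcoeff0 scale0r subr0; apply: bspan0.
have plug_inj : injective (plug q) := strict_mono_inj le_total (@plug_mono q).
have [ew|new] := pselect (plug q (lead s) = w).
  rewrite -[in mapw _ s](monicizeK le_total s) mapwZ scalerA mcoeffZ.
  rewrite -{2}ew mcoeff_mapw // mcoeff_monicize // mulr1 -scalerBr.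
  by apply: bspanZ; rewrite -{1}ew; apply: G_confluent; rewrite // w_def.
rewrite mcoeffZ mcoeff_mapw_eq0 ?mulr0 ?scale0r ?subr0; last first.
  move=> m sm ew; apply: new.
  have [lt_ml|eml] := pselect (strict le m (lead s)); last first.
    by rewrite -ew; congr plug; apply: contrapT => nem; apply: eml;
       split; [exact: lead_max|exact: nesym].
  have := lt_le_trans le_total (plug_mono q lt_ml) Pq.
  by rewrite ew => -[_ /(_ erefl)].
by apply/bspanZ/bspan_gen.
Qed.

Lemma bspan_bound P f : bspan G P f ->
  f = 0 \/ exists2 w, P w & bspan G (fun m => le m w) f.
Proof.
elim=> [|c q s h Gs Pq _ [->|[w Pw Sh]]]; first by left.
  right; exists (plug q (lead s)) => //; rewrite addr0.
  by apply/bspanZ/bspan_gen => //; apply: le_refl.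
have [tot _ trans] := le_total; right.
case: (tot w (plug q (lead s))) => [le_w|le_q].
  exists (plug q (lead s)) => //; apply: bspan_cons => //; first exact: le_refl.
  by apply: bspan_sub Sh => // m lem; apply: trans le_w.
by exists w => //; apply: bspan_cons.
Qed.

(** A representation of [f] has finitely many terms, so it is bounded by some
    [v].  As long as [v] is not below [w], it does not occur in [f], and the bound
    can be lowered; this stops because the order is well-founded. *)
Lemma composition_lemma w f :
  bspan G (fun=> True) f -> (forall m, f@_m != 0 -> strict le m w) ->
  bspan G (fun m => strict le m w) f.
Proof.
move=> /bspan_bound[-> _|[v _ Sf] f_lt]; first exact: bspan0.
have [_ _ _ wf] := le_wf.
elim/(well_founded_ind wf): v Sf => v IH Sf.
case: (le_or_lt le_total w v) => [le_wv|lt_vw]; last first.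
  by apply: bspan_sub Sf => // m lemv; apply: le_lt_trans lt_vw.
have fv : f@_v = 0.
  apply/eqP; apply: contraT => /f_lt lt_vw.
  by case: (lt_irrefl (lt_le_trans le_total lt_vw le_wv)).
have /bspan_bound[->|[v' lt_v' Sf']] := bspan_lower Sf fv; first exact: bspan0.
exact: IH lt_v' Sf'.
Qed.

End CompositionLemma.

(** * One-hole contexts *)

Section Contexts.
Context (Z : choiceType).
Local Notation word := (seq (bletter Z)).

(** Star words are contexts whose structure is not visible: following the path
    from the root to the star makes case analysis on its position possible. *)
Inductive ctx : Type :=
  | Hole of word & word
  | Under of word & ctx & word.

Fixpoint fill (c : ctx) (s : word) : word :=
  match c with
  | Hole a b => a ++ s ++ b
  | Under a c b => a ++ Brack (fill c s) :: b
  end.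

Definition plug_ctx (c : ctx) (u : bword Z) : bword Z := FMonom (fill c u).

Definition ctx_cat (a : word) (c : ctx) (b : word) : ctx :=
  match c with
  | Hole x y => Hole (a ++ x) (y ++ b)
  | Under x c y => Under (a ++ x) c (y ++ b)
  end.

Fixpoint ctx_comp (c d : ctx) : ctx :=
  match c with
  | Hole a b => ctx_cat a d b
  | Under a c b => Under a (ctx_comp c d) b
  end.

Lemma fill_cat a c b s : fill (ctx_cat a c b) s = a ++ fill c s ++ b.
Proof. by case: c => [x y|x c y] /=; rewrite -!catA. Qed.

Lemma fill_comp c d s : fill (ctx_comp c d) s = fill c (fill d s).
Proof. by elim: c => [a b|a c IH b] /=; rewrite ?fill_cat ?IH. Qed.

Lemma plug_ctx_id u : plug_ctx (Hole [::] [::]) u = u.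
Proof. by rewrite /plug_ctx /= cats0 fmK. Qed.

Lemma plug_comp c d : plug_ctx (ctx_comp c d) =1 plug_ctx c \o plug_ctx d.
Proof. by move=> u; rewrite /plug_ctx fill_comp. Qed.

Lemma star_free_subst (s : seq (bletter (option Z))) :
  sumn (map (bletter_occ (fun z => z == None)) s) = 0%N ->
  exists t, forall u, flatten (map (bletter_subst u) s) = t.
Proof.
elim/forest_ind: s => [_|[z|] s IH|t s IHt IHs] //=; first by exists [::].
  by rewrite add0n => /IH[t st]; exists (Atom z :: t) => u; rewrite st.
move/eqP; rewrite addn_eq0 => /andP[/eqP/IHt[t' tt] /eqP/IHs[s' ss]].
by exists (Brack t' :: s') => u; rewrite tt ss.
Qed.

Lemma star_word_ctx (q : star_word Z) : exists c, star_subst q =1 plug_ctx c.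
Proof.
case: q => -[s] q1; rewrite /star_subst /=; move/eqP: q1; rewrite /occ /=.
suff H : sumn (map (bletter_occ (fun z => z == None)) s) = 1%N ->
    exists c, forall u, flatten (map (bletter_subst u) s) = fill c u.
  by move=> /H[c sc]; exists c => u; rewrite /= sc.
elim/forest_ind: s => [|[z|] s IH|t s IHt IHs] //=.
- rewrite add0n => /IH[c sc]; exists (ctx_cat [:: Atom z] c [::]) => u.
  by rewrite fill_cat cats0 sc.
- by move=> /eqP; rewrite eqSS => /eqP/star_free_subst[t st]; exists (Hole [::] t)
    => u; rewrite st.
case t1 : (sumn (map (bletter_occ _) t)) => [|[|//]] /eqP.
- rewrite add0n => /eqP/IHs[c sc].
  have [t' tt] := star_free_subst t1.
  by exists (ctx_cat [:: Brack t'] c [::]) => u; rewrite fill_cat cats0 sc tt.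
- rewrite eqSS => /eqP/star_free_subst[s' ss]; have [c tc] := IHt t1.
  by exists (Under [::] c s') => u; rewrite ss tc.
Qed.

Lemma star_free_lift (t : word) :
  exists s : seq (bletter (option Z)),
    sumn (map (bletter_occ (fun z => z == None)) s) = 0%N /\
    forall u, flatten (map (bletter_subst u) s) = t.
Proof.
elim/forest_ind: t => [|z t [s [s0 st]]|t t' [s [s0 st]] [s' [s'0 s't']]].
- by exists [::].
- by exists (Atom (Some z) :: s); split=> //= u; rewrite st.
- by exists (Brack s :: s'); split=> /= [|u]; rewrite ?s0 ?s'0 ?st ?s't'.
Qed.

Lemma ctx_star_word (c : ctx) : exists q : star_word Z, star_subst q =1 plug_ctx c.
Proof.
suff [s [s1 sc]] : exists s : seq (bletter (option Z)),
    sumn (map (bletter_occ (fun z => z == None)) s) = 1%N /\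
    forall u, flatten (map (bletter_subst u) s) = fill c u.
  have s1' : occ (fun z => z == None) (FMonom s) == 1%N by rewrite /occ s1.
  exists (exist (fun q => is_true (occ _ q == 1%N)) _ s1') => u.
  by rewrite /star_subst /= sc.
elim: c => [a b|a c [s [s1 sc]] b];
  have [sa [sa0 saE]] := star_free_lift a; have [sb [sb0 sbE]] := star_free_lift b.
  exists (sa ++ Atom None :: sb); rewrite map_cat sumn_cat sa0 /= sb0; split=> // u.
  by rewrite map_cat flatten_cat /= saE sbE.
exists (sa ++ Brack s :: sb); rewrite map_cat sumn_cat sa0 /= s1 sb0; split=> // u.
by rewrite map_cat flatten_cat /= saE sbE sc.
Qed.

Definition is_atom (a : bletter Z) : bool := if a is Atom _ then true else false.

Lemma all_is_atom (s : word) :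
  all is_atom s -> exists n : {fmonom Z}, s = word_incl n.
Proof.
elim: s => [_|[z|//] s IH /= /IH[[n] ->]]; first by exists (FMonom [::]).
by exists (FMonom (z :: n)).
Qed.

Lemma word_incl_atoms (n : {fmonom Z}) : all is_atom (word_incl n).
Proof. by rewrite /word_incl /= all_map; apply/allP. Qed.

Lemma word_incl_inj : injective (@word_incl Z).
Proof.
move=> [m] [n] [] /(@inj_map _ _ (@Atom Z)) -> // => x y.
by case.
Qed.

Lemma catI_le (T : Type) (a1 b1 a2 b2 : seq T) :
  a1 ++ b1 = a2 ++ b2 -> (size a1 <= size a2)%N ->
  exists d, a2 = a1 ++ d /\ b1 = d ++ b2.
Proof.
elim: a1 a2 => [|x a1 IH] [|y a2] //=; first by move=> ->; exists [::].
  by move=> -> _; exists (y :: a2).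
by case=> -> /IH{}IH /IH[d [-> ->]]; exists d.
Qed.

(** Independent holes: the two-hole context obtained by abstracting both
    occurrences is given by its two families of one-hole sections. *)
Definition separate (c1 : ctx) (m1 : word) (c2 : ctx) (m2 : word) : Prop :=
  exists D1 D2 : word -> ctx,
    [/\ D1 m2 = c1, D2 m1 = c2 & forall x y, fill (D1 y) x = fill (D2 x) y].

(** Occurrences in one sequence of letters, neither of which ends before the other
    one starts. *)
Definition overlapping (c1 : ctx) (m1 : word) (c2 : ctx) (m2 : word) : Prop :=
  exists c a1 b1 a2 b2,
    [/\ forall s, fill c1 s = fill c (a1 ++ s ++ b1),
        forall s, fill c2 s = fill c (a2 ++ s ++ b2),
        a1 ++ m1 ++ b1 = a2 ++ m2 ++ b2,
        (size a1 < size a2 + size m2)%N & (size a2 < size a1 + size m1)%N].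

Lemma separate_sym c1 m1 c2 m2 : separate c1 m1 c2 m2 -> separate c2 m2 c1 m1.
Proof. by case=> D1 [D2 [? ? D12]]; exists D2, D1; split=> // x y; rewrite D12. Qed.

Lemma separate_holes a1 m1 b1 a2 m2 b2 :
  a1 ++ m1 ++ b1 = a2 ++ m2 ++ b2 -> (size a1 + size m1 <= size a2)%N ->
  separate (Hole a1 b1) m1 (Hole a2 b2) m2.
Proof.
rewrite catA => e; rewrite -size_cat => /(catI_le e)[d [-> ->]].
exists (fun y => Hole a1 (d ++ y ++ b2)), (fun x => Hole ((a1 ++ x) ++ d) b2).
by split=> // x y /=; rewrite -!catA.
Qed.

(** A word of atoms cannot contain a bracket, hence neither the bracket around
    the other occurrence. *)
Lemma separate_hole_under a1 m1 b1 a2 c b2 m2 :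
  all is_atom m1 -> a1 ++ m1 ++ b1 = a2 ++ Brack (fill c m2) :: b2 ->
  separate (Hole a1 b1) m1 (Under a2 c b2) m2.
Proof.
move=> m1a e; case: (leqP (size a1 + size m1) (size a2)) => [|lt_a].
  move: e; rewrite catA => e; rewrite -size_cat => /(catI_le e)[d [-> ->]].
  exists (fun y => Hole a1 (d ++ Brack (fill c y) :: b2)).
  by exists (fun x => Under ((a1 ++ x) ++ d) c b2); split=> // x y /=; rewrite -!catA.
case: (leqP (size a1) (size a2)) => [le_a|].
  have [d [ea ed]] := catI_le e le_a.
  have le_d : (size d <= size m1)%N.
    by move: lt_a; rewrite ea size_cat ltn_add2l => /ltnW.
  have [[|x d'] [em ed']] := catI_le (esym ed) le_d.
    by move: lt_a; rewrite ea em cats0 size_cat ltnn.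
  by case: ed' em m1a => <- _ ->; rewrite all_cat /= andbF.
rewrite -[(size a2).+1]addn1 -[1%N]/(size [:: Brack (fill c m2)]) -size_cat => le_a.
have e' : (a2 ++ [:: Brack (fill c m2)]) ++ b2 = a1 ++ m1 ++ b1 by rewrite -catA e.
have [d [-> ->]] := catI_le e' le_a.
exists (fun y => Hole ((a2 ++ [:: Brack (fill c y)]) ++ d) b1).
exists (fun x => Under a2 c (d ++ x ++ b1)); split=> // x y /=.
by rewrite -!catA.
Qed.

Lemma separate_unders a1 c1 b1 m1 a2 c2 b2 m2 :
  a1 ++ Brack (fill c1 m1) :: b1 = a2 ++ Brack (fill c2 m2) :: b2 ->
  (size a1 < size a2)%N -> separate (Under a1 c1 b1) m1 (Under a2 c2 b2) m2.
Proof.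
move=> e; rewrite -[(size a1).+1]addn1 -[1%N]/(size [:: Brack (fill c1 m1)]).
rewrite -size_cat => le_a.
have e' : (a1 ++ [:: Brack (fill c1 m1)]) ++ b1 =
    a2 ++ Brack (fill c2 m2) :: b2 by rewrite -catA.
have [d [-> ->]] := catI_le e' le_a.
exists (fun y => Under a1 c1 (d ++ Brack (fill c2 y) :: b2)).
exists (fun x => Under ((a1 ++ [:: Brack (fill c1 x)]) ++ d) c2 b2).
by split=> // x y /=; rewrite -!catA.
Qed.

(** At the point where the paths to the two holes part, each occurrence is either
    a factor of the common sequence of letters or inside one of its brackets; a
    word of atoms avoids that bracket, so only two factors can overlap. *)
Lemma separate_or_overlapping c1 m1 c2 m2 :
  all is_atom m1 -> all is_atom m2 -> fill c1 m1 = fill c2 m2 ->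
  separate c1 m1 c2 m2 \/ overlapping c1 m1 c2 m2.
Proof.
move=> m1a m2a; elim: c1 c2 => [a1 b1|a1 c1 IH b1] [a2 b2|a2 c2 b2] /= e.
- case: (leqP (size a1 + size m1) (size a2)) => [le12|lt21].
    by left; apply: separate_holes.
  case: (leqP (size a2 + size m2) (size a1)) => [le21|lt12].
    by left; apply/separate_sym/separate_holes.
  right; exists (Hole [::] [::]), a1, b1, a2, b2.
  by split=> // s; rewrite /= cats0.
- by left; apply: separate_hole_under.
- by left; apply/separate_sym/separate_hole_under.
- case: (ltngtP (size a1) (size a2)) => [lt|lt|eq_a].
  + by left; apply: separate_unders.
  + by left; apply/separate_sym/separate_unders.
  move/eqP: e; rewrite eqseq_cat // => /andP[/eqP <- /eqP[]].
  case/IH=> [[D1 [D2 [<- <- D12]]] <-|].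
    left; exists (fun y => Under a1 (D1 y) b1), (fun x => Under a1 (D2 x) b1).
    by split=> // x y /=; rewrite D12.
  case=> c [a [b [a' [b' [c1E c2E eab lt lt']]]]] <-.
  right; exists (Under a1 c b1), a, b, a', b'.
  by split=> // s /=; rewrite ?c1E ?c2E.
Qed.

(** The minimal overlaps, from which the other ones arise by plugging into [c]:
    one of the two words starts their union, and one of them ends it. *)
Definition minimal_overlap (c1 : ctx) (n1 : {fmonom Z}) (c2 : ctx)
    (n2 : {fmonom Z}) : Prop :=
  exists c (x1 y1 x2 y2 : {fmonom Z}),
    [/\ forall s, fill c1 s = fill c (word_incl x1 ++ s ++ word_incl y1),
        forall s, fill c2 s = fill c (word_incl x2 ++ s ++ word_incl y2),
        [/\ mmul x1 (mmul n1 y1) = mmul x2 (mmul n2 y2),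
            (size x1 < size x2 + size n2)%N & (size x2 < size x1 + size n1)%N],
        x1 = mone \/ x2 = mone & y1 = mone \/ y2 = mone].

Lemma minimal_overlap_sym c1 n1 c2 n2 :
  minimal_overlap c1 n1 c2 n2 -> minimal_overlap c2 n2 c1 n1.
Proof.
case=> c [x1 [y1 [x2 [y2 [? ? [? ? ?] ? ?]]]]].
by exists c, x2, y2, x1, y1; split=> //; exact/or_comm.
Qed.

Lemma overlapping_minimal c1 c2 (n1 n2 : {fmonom Z}) :
  overlapping c1 (word_incl n1) c2 (word_incl n2) ->
  minimal_overlap c1 n1 c2 n2.
Proof.
case=> c [a1 [b1 [a2 [b2]]]].
have sn (n : {fmonom Z}) : size (word_incl n) = size n by rewrite /= size_map.
rewrite !sn; wlog le_a : c1 c2 n1 n2 a1 b1 a2 b2 / (size a1 <= size a2)%N.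
  move=> key ov; case/orP: (leq_total (size a1) (size a2)) => le_a.
    exact: (key _ _ _ _ _ _ _ _ le_a ov).
  case: ov => c1E c2E e lt1 lt2; apply: minimal_overlap_sym.
  by apply: (key _ _ _ _ a2 b2 a1 b1 le_a); split.
case=> c1E c2E e lt1 lt2.
have [d [ea ed]] := catI_le e le_a.
have lt_d : (size d < size n1)%N by move: lt2; rewrite ea size_cat ltn_add2l.
have [|m [n1E mE]] := catI_le (esym ed); first by rewrite sn ltnW.
have := word_incl_atoms n1; rewrite n1E all_cat => /andP[da ma].
have [x dE] := all_is_atom da.
have one : word_incl (mone : {fmonom Z}) = [::] :> word by rewrite /word_incl fm1.
have ssx : size x = size d by rewrite dE sn.
have fillH a b s : fill (Hole a b) s = a ++ s ++ b :> word by [].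
have inclP (u v : {fmonom Z}) : word_incl u = word_incl v :> word -> u = v.
  by move=> uv; apply: word_incl_inj; apply/eqP; rewrite fmP uv.
have inclM (u v : {fmonom Z}) :
    word_incl (mmul u v) = word_incl u ++ word_incl v :> word.
  by rewrite word_incl_mul fmM.
case/orP: (leq_total (size m) (size n2)) => le_m.
  have [|r [n2E rE]] := catI_le (esym mE); first by rewrite sn.
  have := word_incl_atoms n2; rewrite n2E all_cat => /andP[_ /all_is_atom[y yE]].
  exists (ctx_comp c (Hole a1 b2)), mone, y, x, mone; split; [| | |by left|by right].
  - by move=> s; rewrite fill_comp c1E fillH one rE yE -?catA.
  - by move=> s; rewrite fill_comp c2E fillH one ea dE -?catA.
  split; last by rewrite fm1 ssx.
    apply: inclP; rewrite !inclM one n1E n2E -yE dE.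
    by rewrite cats0 -!catA.
  rewrite fm1 addn_gt0; apply/orP; right.
  rewrite -sn n2E size_cat addn_gt0; apply/orP; left.
  by move: lt_d; rewrite -sn n1E size_cat -ltn_subLR // subnn.
have [|r [mE' rE]] := catI_le mE; first by rewrite sn.
have := ma; rewrite mE' all_cat => /andP[_ /all_is_atom[y yE]].
exists (ctx_comp c (Hole a1 b1)), mone, mone, x, y; split; [| | |by left|by left].
- by move=> s; rewrite fill_comp c1E fillH one -?catA.
- by move=> s; rewrite fill_comp c2E fillH ea dE rE yE -!catA.
split; last by rewrite fm1 ssx.
  by apply: inclP; rewrite !inclM one n1E mE' -yE dE cats0.
rewrite fm1; move: lt1; rewrite ea size_cat -addnA -[X in (X < _)%N]addn0.
by rewrite ltn_add2l ssx.
Qed.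

End Contexts.

(** * Critical pairs of associative relations in bracketed words *)

Lemma subr_through (V : zmodType) (a b c : V) : a - b = c - b - (c - a).
Proof. by rewrite opprB [RHS]addrC addrA addrNK. Qed.

Section LinearSpan.
Context (k : fieldType) (M : monomType).

Lemma lin_bspan (T : choiceType) le (C : Type) (plug : C -> {fmonom T} -> {fmonom T})
    (G : set {malg k[{fmonom T}]}) P (L : {malg k[M]} -> {malg k[{fmonom T}]}) f :
  lin L -> (forall m, f@_m != 0 -> bspan le plug G P (L << m >>)) ->
  bspan le plug G P (L f).
Proof.
move=> linL; have [LD LZ] := linL; move: f.
apply: malg_ind => [|c m f Lm Lf]; first by rewrite (lin0 linL); apply: bspan0.
by rewrite LD; apply: bspanD Lf; rewrite [L _]LZ; apply: bspanZ.
Qed.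

Lemma lin_supp (N : monomType) (P : N -> Prop) (L : {malg k[M]} -> {malg k[N]}) f :
  lin L -> (forall m n, f@_m != 0 -> (L << m >>)@_n != 0 -> P n) ->
  forall n, (L f)@_n != 0 -> P n.
Proof.
move=> linL; have [LD LZ] := linL => Lf n.
have {Lf} Lf m : f@_m != 0 -> (L << m >>)@_n != 0 -> P n by move=> fm; apply: Lf.
move: f Lf; apply: malg_ind => [|c m f Lm Lf].
  by rewrite (lin0 linL) mcoeff0 eqxx.
rewrite LD mcoeffD [L (_ *: _)]LZ [(uscale _ _)@__]mcoeffZ.
have [->|/Lm //] := eqVneq ((L << m >>)@_n) 0.
by rewrite mulr0 add0r.
Qed.

End LinearSpan.

Lemma bspan_plug (k : fieldType) (T : choiceType) le (C C' : Type)
    (plug : C -> {fmonom T} -> {fmonom T}) (plug' : C' -> {fmonom T} -> {fmonom T})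
    (G : set {malg k[{fmonom T}]}) P f :
  (forall q, exists q', plug q =1 plug' q') ->
  bspan le plug G P f -> bspan le plug' G P f.
Proof.
move=> plugE; elim=> [|c q s h Gs Pq _ IH]; first exact: bspan0.
have [q' qE] := plugE q; rewrite (eq_mapw qE); apply: bspan_cons => //.
by rewrite -qE.
Qed.

Section BilinearMonomialMaps.
Context (k : fieldType) (M : monomType) (F : M -> M -> M).
Local Notation kM := {malg k[M]}.

Definition mapw2 (f g : kM) : kM := linext (fun u => mapw (F u) g) f.

Lemma mapw2Ul u g : mapw2 << u >> g = mapw (F u) g.
Proof. exact: linextU. Qed.

Lemma mapw2_linl g : lin (mapw2 ^~ g).
Proof. exact: lin_linext. Qed.

Lemma mapw2_linr f : lin (mapw2 f).
Proof.
split=> [g h|c g].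
  move: f; apply: (lin_eq (f := mapw2 ^~ (g + h))
    (g := fun f => mapw2 f g + mapw2 f h)).
  - exact: mapw2_linl.
  - exact: lin_add (mapw2_linl g) (mapw2_linl h).
  - by move=> u; rewrite !mapw2Ul mapwD.
move: f; apply: (lin_eq (f := mapw2 ^~ (uscale c g))
  (g := fun f => uscale c (mapw2 f g))).
- exact: mapw2_linl.
- exact: lin_scale (mapw2_linl g).
- by move=> u; rewrite !mapw2Ul [LHS]mapwZ.
Qed.

Lemma mapw2Ur f v : mapw2 f << v >> = mapw (F ^~ v) f.
Proof.
apply: (lin_eq (f := mapw2 ^~ << v >>)) => [||u].
- exact: mapw2_linl.
- exact: lin_mapw.
- by rewrite mapw2Ul !mapwU.
Qed.

End BilinearMonomialMaps.

Section AssociativeInBracketed.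
Context (k : fieldType) (Z : choiceType).
Local Notation kM := {malg k[{fmonom Z}]}.
Local Notation kZ := {malg k[bword Z]}.
Context (le0 : {fmonom Z} -> {fmonom Z} -> Prop) (le : bword Z -> bword Z -> Prop).
Hypothesis le_monomial : monomial_order le.
Hypothesis le_incl : forall u v, le (word_incl u) (word_incl v) <-> le0 u v.

Let le_total : total_order le := well_order_total le_monomial.1.

(** The order on associative words is the restriction of the order on bracketed
    words, from which it inherits what is needed. *)
Lemma le0_total : total_order le0.
Proof.
have [tot asym trans] := le_total; split=> [x y|x y|x y z].
- by case: (tot (word_incl x) (word_incl y)) => /le_incl; [left|right].
- by move=> /le_incl lexy /le_incl leyx; apply/word_incl_inj/asym.
- by move=> /le_incl lexy /le_incl leyz; apply/le_incl/trans/leyz.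
Qed.

Lemma word_incl_mono u v : strict le0 u v -> strict le (word_incl u) (word_incl v).
Proof. by move=> [/le_incl leuv neuv]; split=> // /word_incl_inj. Qed.

Lemma plug_ctx_mono c u v :
  strict le u v -> strict le (plug_ctx c u) (plug_ctx c v).
Proof.
by have [q qE] := ctx_star_word c; rewrite -!qE; apply: le_monomial.2.
Qed.

Lemma lead_incl (s : kM) : lead le (malg_incl s) = word_incl (lead le0 s).
Proof.
have [->|s0] := eqVneq s 0; last first.
  exact (lead_mapw le0_total le_total word_incl_mono s0).

by rewrite malg_inclE mapw0 !lead0; apply/eqP; rewrite fmP /word_incl !fm1.
Qed.

Lemma monicize_incl (s : kM) :
  s != 0 -> monicize le (malg_incl s) = malg_incl (monicize le0 s).
Proof. exact (@monicize_mapw _ _ _ _ _ le0_total le_total _ word_incl_mono s). Qed.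

Lemma word_incl_plug (x y u : {fmonom Z}) :
  word_incl (assoc_plug (x, y) u) =
  plug_ctx (Hole (word_incl x) (word_incl y)) (word_incl u).
Proof.
rewrite -[assoc_plug _ _]/(mmul x (mmul u y)).
by apply/eqP; rewrite fmP !word_incl_mul !fmM.
Qed.

(** The embedding of associative words followed by a context is increasing, so
    it transports bounded representations. *)
Lemma bspan_incl (G : set kM) P Q f c :
  (forall m, P m -> Q (plug_ctx c (word_incl m))) ->
  bspan le0 (@assoc_plug Z) G P f ->
  bspan le (@plug_ctx Z) [set malg_incl g | g in G] Q
    (mapw (plug_ctx c \o @word_incl Z) f).
Proof.
move=> PQ; elim=> [|d [x y] s h Gs Pq _ IH]; first by rewrite mapw0; apply: bspan0.
rewrite mapwD mapwZ mapw_comp.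
pose c' := ctx_comp c (Hole (word_incl x) (word_incl y)).
have c'E : plug_ctx c \o @word_incl Z \o assoc_plug (x, y) =1
    plug_ctx c' \o @word_incl Z.
  by move=> u; rewrite /= /c' plug_comp /=; congr plug_ctx; apply: word_incl_plug.
rewrite (eq_mapw c'E) -mapw_comp.
apply: bspan_cons IH; first by exists s.
by rewrite lead_incl; have := c'E (lead le0 s) => /= <-; apply: PQ.
Qed.

Context (G : set kM).
Hypothesis G_GS : GS_basis le0 (@assoc_plug Z) G.

Lemma assoc_plug1 (f : kM) : mapw (assoc_plug (mone, mone)) f = f.
Proof.
rewrite -[RHS]mapw_id; apply: eq_mapw => u.
by rewrite /assoc_plug /= mul1m mulm1.
Qed.

Lemma assoc_inclusion g1 g2 x y :
  G g1 -> G g2 -> g1 != 0 -> g2 != 0 ->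
  lead le0 g1 = mmul x (mmul (lead le0 g2) y) ->
  bspan le0 (@assoc_plug Z) G (fun m => strict le0 m (lead le0 g1))
    (monicize le0 g1 - mapw (assoc_plug (x, y)) (monicize le0 g2)).
Proof.
move=> Gg1 Gg2 g10 g20 e; apply/trivial_modP.
exact: (G_GS Gg1 Gg2 g10 g20).2.
Qed.

(** Depending on which words are trivial, the overlap is an inclusion of one
    leading monomial in the other or an intersection. *)
Lemma assoc_composition g1 g2 x1 y1 x2 y2 :
  G g1 -> G g2 -> g1 != 0 -> g2 != 0 ->
  mmul x1 (mmul (lead le0 g1) y1) = mmul x2 (mmul (lead le0 g2) y2) ->
  (size x1 < size x2 + size (lead le0 g2))%N ->
  (size x2 < size x1 + size (lead le0 g1))%N ->
  x1 = mone \/ x2 = mone -> y1 = mone \/ y2 = mone ->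
  bspan le0 (@assoc_plug Z) G
    (fun m => strict le0 m (mmul x1 (mmul (lead le0 g1) y1)))
    (mapw (assoc_plug (x1, y1)) (monicize le0 g1) -
     mapw (assoc_plug (x2, y2)) (monicize le0 g2)).
Proof.
wlog x10 : g1 g2 x1 y1 x2 y2 / x1 = mone.
  move=> key Gg1 Gg2 g10 g20 e lt1 lt2 [x10|x20] y12; first by apply: key => //; left.
  rewrite -opprB e; apply/bspanN/key => //; first by left.
  exact/or_comm.
rewrite {}x10 => Gg1 Gg2 g10 g20 e _ lt2 _ [y10|y20].
  move: e; rewrite {}y10 assoc_plug1 !mul1m !mulm1 => e.
  exact: assoc_inclusion.
move: e lt2; rewrite {}y20 !mul1m mulm1 fm1 add0n => e lt2.
(* intersections require both remaining factors to be nontrivial *)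
have [x20|x20] := eqVneq x2 mone.
  rewrite {}x20 assoc_plug1 mul1m in e *.
  rewrite -opprB e; apply/bspanN/assoc_inclusion => //.
  by rewrite mul1m e.
have [y10|y10] := eqVneq y1 mone.
  rewrite {}y10 assoc_plug1 mulm1 in e *.
  by apply: assoc_inclusion => //; rewrite mulm1.
have -> : mapw (assoc_plug (mone, y1)) (monicize le0 g1) =
    monicize le0 g1 * << y1 >>.
  by rewrite mulmapwU; apply: eq_mapw => u; rewrite /assoc_plug /= mul1m.
have -> : mapw (assoc_plug (x2, mone)) (monicize le0 g2) =
    << x2 >> * monicize le0 g2.
  by rewrite mulUmapw; apply: eq_mapw => u; rewrite /assoc_plug /= mulm1.
apply/trivial_modP; apply: ((G_GS Gg1 Gg2 g10 g20).1 _ _ _ erefl e).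
have size_gt0 (z : {fmonom Z}) : z != mone -> (0 < size z)%N.
  by move=> z0; rewrite lt0n; apply: contra z0; rewrite -fdegE fdeg_eq0.
have size_e : (size (lead le0 g1) + size y1 = size x2 + size (lead le0 g2))%N.
  by move/(congr1 (fun z : {fmonom Z} => size z)): e; rewrite !fmM !size_cat.
rewrite fmM size_cat ltn_add2l gtn_max -{1}[size (lead _ g1)]addn0 ltn_add2l.
rewrite size_gt0 // size_e -{1}[size (lead _ g2)]add0n ltn_add2r size_gt0 //=.
by rewrite -(ltn_add2l (size (lead le0 g1))) size_e ltn_add2r.
Qed.

(** With [F] the two-hole context, [f1] and [f2] the monic relations, [n1] and
    [n2] their leading monomials, [F(f1, n2) - F(n1, f2)] equals
    [F(f1 - n1, f2) - F(f1, f2 - n2)]: each term plugs a whole relation next to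
    a monomial of a tail, hence below the common monomial [F(n1, n2)]. *)
Lemma separate_confluent (H : set kZ) c1 s1 c2 s2 :
  H s1 -> H s2 -> s1 != 0 -> s2 != 0 ->
  separate c1 (lead le s1) c2 (lead le s2) ->
  bspan le (@plug_ctx Z) H (fun m => strict le m (plug_ctx c1 (lead le s1)))
    (mapw (plug_ctx c1) (monicize le s1) - mapw (plug_ctx c2) (monicize le s2)).
Proof.
move=> Hs1 Hs2 s10 s20 [D1 [D2 [D1E D2E D12]]].
set n1 := lead le s1 in D2E *; set n2 := lead le s2 in D1E *.
set f1 := monicize le s1; set f2 := monicize le s2.
pose F (x y : bword Z) := plug_ctx (D1 y) x.
have FE x y : F x y = plug_ctx (D2 x) y by rewrite /F /plug_ctx D12.
have -> : mapw (plug_ctx c1) f1 = mapw2 F f1 << n2 >>.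
  by rewrite mapw2Ur; apply: eq_mapw => x; rewrite /F D1E.
have -> : mapw (plug_ctx c2) f2 = mapw2 F << n1 >> f2.
  by rewrite mapw2Ul; apply: eq_mapw => y; rewrite FE D2E.
have wE : plug_ctx c1 n1 = F n1 n2 by rewrite /F D1E.
have -> : mapw2 F f1 << n2 >> - mapw2 F << n1 >> f2 =
    mapw2 F (f1 - << n1 >>) f2 - mapw2 F f1 (f2 - << n2 >>).
  rewrite (linB _ _ (mapw2_linl _ _)) (linB _ _ (mapw2_linr _ _)).
  exact: subr_through.
rewrite wE; apply: bspanB.
  apply: (lin_bspan (mapw2_linl _ _)) => x /(monic_tail le_total s10) lt_x.
  rewrite mapw2Ul (eq_mapw (FE x)) /f2 /monicize mapwZ.
  apply/bspanZ/bspan_gen => //; rewrite -FE /F.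
  exact: plug_ctx_mono.
apply: (lin_bspan (mapw2_linr _ _)) => y /(monic_tail le_total s20) lt_y.
rewrite mapw2Ur /F /f1 /monicize mapwZ.
apply/bspanZ/bspan_gen => //; rewrite -!/(F _ _) !FE.
exact: plug_ctx_mono.
Qed.

Local Notation iG := [set malg_incl g | g in G].

Lemma overlapping_confluent c1 g1 c2 g2 :
  G g1 -> G g2 -> g1 != 0 -> g2 != 0 ->
  overlapping c1 (word_incl (lead le0 g1)) c2 (word_incl (lead le0 g2)) ->
  bspan le (@plug_ctx Z) iG
    (fun m => strict le m (plug_ctx c1 (word_incl (lead le0 g1))))
    (mapw (plug_ctx c1 \o @word_incl Z) (monicize le0 g1) -
     mapw (plug_ctx c2 \o @word_incl Z) (monicize le0 g2)).
Proof.
move=> Gg1 Gg2 g10 g20 /overlapping_minimal.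
case=> c [x1 [y1 [x2 [y2 [c1E c2E [e lt1 lt2] x12 y12]]]]].
have plugE d x y : (forall s, fill d s = fill c (word_incl x ++ s ++ word_incl y)) ->
    plug_ctx d \o @word_incl Z =1 plug_ctx c \o @word_incl Z \o assoc_plug (x, y).
  by move=> dE u; rewrite /= /plug_ctx dE; rewrite word_incl_plug.
rewrite (eq_mapw (plugE _ _ _ c1E)) (eq_mapw (plugE _ _ _ c2E)).
rewrite -(mapw_comp (assoc_plug (x1, y1))) -(mapw_comp (assoc_plug (x2, y2))) -mapwB.
have := plugE _ _ _ c1E (lead le0 g1) => /= ->.
apply: bspan_incl (assoc_composition Gg1 Gg2 g10 g20 e lt1 lt2 x12 y12) => m lt_m.
by apply/plug_ctx_mono/word_incl_mono.
Qed.

Lemma mapw_monicize_incl c (g : kM) : g != 0 ->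
  mapw (plug_ctx c) (monicize le (malg_incl g)) =
  mapw (plug_ctx c \o @word_incl Z) (monicize le0 g) :> kZ.
Proof. by move=> g0; rewrite monicize_incl // -mapw_comp. Qed.

(** The relations of [G] satisfy in bracketed words the hypothesis of the
    composition lemma, so that it applies to them apart from the identity. *)
Lemma incl_confluent s1 s2 c1 c2 :
  iG s1 -> iG s2 -> s1 != 0 -> s2 != 0 ->
  plug_ctx c1 (lead le s1) = plug_ctx c2 (lead le s2) ->
  bspan le (@plug_ctx Z) iG (fun m => strict le m (plug_ctx c1 (lead le s1)))
    (mapw (plug_ctx c1) (monicize le s1) - mapw (plug_ctx c2) (monicize le s2)).
Proof.
move=> iG1 iG2 s10 s20 e.
have [g1 Gg1 s1E] := iG1; have [g2 Gg2 s2E] := iG2.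
have l1 : lead le s1 = word_incl (lead le0 g1) by rewrite -s1E lead_incl.
have l2 : lead le s2 = word_incl (lead le0 g2) by rewrite -s2E lead_incl.
have a1 : all (@is_atom Z) (lead le s1) by rewrite l1; apply: word_incl_atoms.
have a2 : all (@is_atom Z) (lead le s2) by rewrite l2; apply: word_incl_atoms.
have e' : fill c1 (lead le s1) = fill c2 (lead le s2) by case: e.
have [sep|] := separate_or_overlapping a1 a2 e'.
  exact: separate_confluent iG1 iG2 s10 s20 sep.
have g10 : g1 != 0 by apply: contraNneq s10 => g10; rewrite -s1E g10 malg_inclE mapw0.
have g20 : g2 != 0 by apply: contraNneq s20 => g20; rewrite -s2E g20 malg_inclE mapw0.
have mE c s (g : kM) : g != 0 -> malg_incl g = s ->
    mapw (plug_ctx c) (monicize le s) =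
    mapw (plug_ctx c \o @word_incl Z) (monicize le0 g).
  by move=> g0 <-; apply: mapw_monicize_incl.
rewrite (mE _ _ _ g10 s1E) (mE _ _ _ g20 s2E) l1 l2.
exact: overlapping_confluent.
Qed.

End AssociativeInBracketed.

(** * Compositions with the operated identity *)

Lemma mulU_plug (k : fieldType) (Z : choiceType) (m : bword Z)
    (f : {malg k[bword Z]}) :
  << m >> * f = mapw (plug_ctx (Hole m [::])) f.
Proof.
rewrite mulUmapw; apply: eq_mapw => n.
by apply/eqP; rewrite fmP fmM /= cats0.
Qed.

Lemma mulr_plug (k : fieldType) (Z : choiceType) (m : bword Z)
    (f : {malg k[bword Z]}) :
  f * << m >> = mapw (plug_ctx (Hole [::] m)) f.
Proof. by rewrite mulmapwU; apply: eq_mapw => n; apply/eqP; rewrite fmP fmM. Qed.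

Section SpanIdeal.
Context (k : fieldType) (Z : choiceType) (le : bword Z -> bword Z -> Prop).
Local Notation kZ := {malg k[bword Z]}.
Context (H : set kZ).
Local Notation K := (bspan le (@plug_ctx Z) H (fun=> True)).

Lemma bspan_mem (P : bword Z -> Prop) s :
  H s -> P (lead le s) -> bspan le (@plug_ctx Z) H P s.
Proof.
have e : mapw (plug_ctx (Hole [::] [::])) s = s.
  by rewrite (eq_mapw (@plug_ctx_id Z)) mapw_id.
move=> Hs Ps; rewrite -e; apply: bspan_gen => //.
by rewrite plug_ctx_id.
Qed.

Lemma bspan_plug_ctx d f : K f -> K (mapw (plug_ctx d) f).
Proof.
elim=> [|c q s h Gs _ _ IH]; first by rewrite mapw0; apply: bspan0.
rewrite mapwD mapwZ mapw_comp -(eq_mapw (plug_comp d q)).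
exact: bspan_cons.
Qed.

Lemma bspan_mull a f : K f -> K (a * f).
Proof.
move=> Kf; apply: (lin_bspan (L := fun a => a * f)) => [|m _].
  exact: lin_mulr.
by rewrite mulU_plug; apply: bspan_plug_ctx.
Qed.

Lemma bspan_mulr a f : K f -> K (f * a).
Proof.
move=> Kf; apply: (lin_bspan (L := fun a => f * a)) => [|m _].
  exact: lin_mull.
by rewrite mulr_plug; apply: bspan_plug_ctx.
Qed.

Lemma bspan_oper f : K f -> K (oper f).
Proof.
have mE : @brack Z =1 plug_ctx (Under [::] (Hole [::] [::]) [::]).
  by move=> n; apply/eqP; rewrite fmP /= cats0.
rewrite -[oper f]/(mapw (@brack Z) f) (eq_mapw mE).
exact: bspan_plug_ctx.
Qed.

Definition bspan_opideal : opideal kZ :=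
  @OpIdeal k kZ (@Ideal kZ K (bspan0 _ _ _ _) (@bspanD _ _ _ _ _ _ _)
    bspan_mull bspan_mulr) bspan_oper.

End SpanIdeal.

Section Compositions.
Context (k : fieldType) (Z : choiceType).
Local Notation kM := {malg k[{fmonom Z}]}.
Local Notation kZ := {malg k[bword Z]}.
Context (le0 : {fmonom Z} -> {fmonom Z} -> Prop) (le : bword Z -> bword Z -> Prop).
Hypothesis le_monomial : monomial_order le.
Hypothesis le_incl : forall u v, le (word_incl u) (word_incl v) <-> le0 u v.
Context (G : set kM).
Hypothesis G_GS : GS_basis le0 (@assoc_plug Z) G.
Context (S : set kZ).

Let le_total : total_order le := well_order_total le_monomial.1.
Local Notation iG := [set malg_incl g | g in G].
Local Notation H := (S `|` iG).
Local Notation below w := (fun m => strict le m w).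
Local Notation hspan := (bspan le (@plug_ctx Z)).

Let plug_mono := plug_ctx_mono le_monomial.

Lemma incl_composition_lemma w f :
  hspan iG (fun=> True) f -> (forall m, f@_m != 0 -> strict le m w) ->
  hspan iG (below w) f.
Proof.
apply: composition_lemma; first exact: le_monomial.1.
  exact: plug_mono.
exact: incl_confluent.
Qed.

(** A relation with leading monomial [1] makes everything trivial: it replaces
    any monomial by smaller ones. *)
Lemma lead1_trivial (s : kZ) w m :
  H s -> s != 0 -> lead le s = mone -> strict le m w -> hspan H (below w) << m >>.
Proof.
move=> Hs s0 s1; have [_ _ _ wf] := le_monomial.1.
elim/(well_founded_ind wf): m => m IH lt_m.
pose c := Hole m [::] : ctx Z.
have cE u : plug_ctx c u = mmul m u.
  by apply/eqP; rewrite fmP fmM /= cats0.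
have -> : << m >> = mapw (plug_ctx c) (monicize le s) -
    mapw (plug_ctx c) (monicize le s - << lead le s >>) :> kZ.
  by rewrite mapwB mapwU s1 cE mulm1 opprB addrC addrNK.
apply: bspanB.
  rewrite /monicize mapwZ; apply/bspanZ/bspan_gen => //.
  by rewrite s1 cE mulm1.
apply: (lin_bspan (lin_mapw _)) => n /(monic_tail le_total s0); rewrite s1 => lt_n.
rewrite mapwU; have lt_nm : strict le (plug_ctx c n) m.
  by have := plug_mono c lt_n; rewrite [X in strict _ _ X]cE mulm1.
apply: IH => //; case: lt_nm => le_nm _.
exact: le_lt_trans le_nm lt_m.
Qed.

(** Here [Phi] is the operated identity in one of its variables, [frame u] its
    leading monomial at [u] and [Beta] its lower part; the relation [s] is
    plugged into that variable.  The composition is the sum of instances of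
    [Phi] at smaller monomials and of [Beta] at the whole plugged relation.  The
    latter lies in the ideal of [G] and has only small monomials; as distinct
    terms of [Beta] may cancel, its terms need not be small one by one, and the
    composition lemma is what provides a representation below the bound. *)
Lemma frame_composition (Phi Beta : kZ -> kZ) (frame : bword Z -> bword Z) c d s :
  lin Phi -> lin Beta ->
  (forall x, mapw frame x = Phi x + Beta x) ->
  (forall u, S (Phi << u >>)) -> (forall u, lead le (Phi << u >>) = frame u) ->
  (forall u m, (Beta << u >>)@_m != 0 -> strict le m (frame u)) ->
  (forall x, hspan iG (fun=> True) x -> hspan iG (fun=> True) (Beta x)) ->
  frame \o plug_ctx c =1 plug_ctx d ->
  iG s -> s != 0 ->
  hspan H (below (plug_ctx d (lead le s)))
    (Phi << plug_ctx c (lead le s) >> - mapw (plug_ctx d) (monicize le s)).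
Proof.
move=> linPhi linBeta frameE PhiS Phi_lead Beta_lt Beta_ideal cd iGs s0.
set n := lead le s; set f := monicize le s.
have linc := lin_mapw (k := k) (plug_ctx c).
rewrite -(eq_mapw cd) -mapw_comp frameE opprD addrA.
rewrite -(mapwU k (plug_ctx c)) -(linB _ _ linPhi) -mapwB -[<< n >> - f]opprB.
rewrite (linN _ linc) (linN _ linPhi).
apply: bspanB; first apply: bspanN.
  (* the tail of the relation: an instance of the identity for each monomial *)
  apply: (lin_bspan (lin_comp linc linPhi)) => m /(monic_tail le_total s0) lt_m.
  rewrite /= mapwU; apply: bspan_mem; first exact: or_introl (PhiS _).
  by rewrite Phi_lead -[frame _]/((frame \o plug_ctx c) m) cd; apply: plug_mono.
apply: (bspan_sub (G := iG) (P := below (plug_ctx d n))) => //.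
apply: incl_composition_lemma.
  apply/Beta_ideal/bspan_plug_ctx; rewrite /f /monicize.
  exact/bspanZ/bspan_mem.
apply: (lin_supp (lin_comp linc linBeta)) => u m fu.
rewrite /= mapwU => /Beta_lt lt_m; apply: lt_le_trans lt_m _ => //.
rewrite -[frame _]/((frame \o plug_ctx c) u) cd.
by apply: (mono_le le_total (@plug_mono d)); apply: monicize_supp fu.
Qed.

End Compositions.

Section Union.
Context (k : fieldType) (Z : choiceType).
Local Notation kM := {malg k[{fmonom Z}]}.
Local Notation kZ := {malg k[bword Z]}.
Context (le0 : {fmonom Z} -> {fmonom Z} -> Prop) (le : bword Z -> bword Z -> Prop).
Hypothesis le_monomial : monomial_order le.
Hypothesis le_incl : forall u v, le (word_incl u) (word_incl v) <-> le0 u v.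
Context (G : set kM).
Hypothesis G_GS : GS_basis le0 (@assoc_plug Z) G.
Context (B : opi k).
Hypothesis B_lin : bilinear_opi B.
Let phi : opi k := oper (@opi_x k) * oper (@opi_y k) - oper B.
Hypothesis phi_lead : forall u v : bword Z,
  lead le (opi_at phi (<< u >> : kZ) << v >>) = mmul (brack u) (brack v).
Hypothesis phi_GS : GS_basis le (@star_subst Z) (@S_opi k phi Z).

Let le_total : total_order le := well_order_total le_monomial.1.
Let plug_mono := plug_ctx_mono le_monomial.
Local Notation iG := [set malg_incl g | g in G].
Local Notation H := (@S_opi k phi Z `|` iG).
Local Notation below w := (fun m => strict le m w).
Local Notation hspan := (bspan le (@plug_ctx Z)).
Local Notation brack2 u v := (mmul (brack u) (brack v)).

Lemma phiE (u v : bword Z) :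
  opi_at phi (<< u >> : kZ) << v >> =
  << brack2 u v >> - oper (opi_at B (<< u >> : kZ) << v >>).
Proof. by rewrite /phi opi_at_rota_baxter !operU malgUM. Qed.

Lemma size_brack2 (u v : bword Z) : size (brack2 u v) = 2%N.
Proof. by rewrite fmM. Qed.

Lemma oper_B_brack2 (u v u' v' : bword Z) :
  (oper (opi_at B (<< u >> : kZ) << v >>))@_(brack2 u' v') = 0.
Proof.
apply: (mcoeff_mapw_eq0 (F := @brack Z)) => n _ e.
by have := size_brack2 u' v'; rewrite -e.
Qed.

Lemma phi_coeff (u v : bword Z) :
  (opi_at phi (<< u >> : kZ) << v >>)@_(brack2 u v) = 1.
Proof. by rewrite phiE mcoeffB oper_B_brack2 mcoeffUU subr0. Qed.

(** The leading monomial of the identity bounds those monomials of its lower part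
    that survive after evaluation. *)
Lemma oper_B_below (u v m : bword Z) :
  (oper (opi_at B (<< u >> : kZ) << v >>))@_m != 0 -> strict le m (brack2 u v).
Proof.
have [->|ne] := eqVneq m (brack2 u v); first by rewrite oper_B_brack2 eqxx.
move=> Bm; split; last exact/eqP.
rewrite -phi_lead; apply: (lead_max le_total).
by rewrite phiE mcoeffB mcoeffU1 [_ == m]eq_sym (negbTE ne) sub0r oppr_eq0.
Qed.

Lemma monicize_phi (u v : bword Z) :
  monicize le (opi_at phi (<< u >> : kZ) << v >>) = opi_at phi << u >> << v >>.
Proof. by apply: monicize_monic; rewrite phi_lead phi_coeff. Qed.

Lemma phi_framel (v : bword Z) (x : kZ) :
  mapw (fun u => brack2 u v) x =
  opi_at phi x << v >> + oper (opi_at B x << v >>).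
Proof.
move: x; apply: (lin_eq (g := fun x =>
  opi_at phi x << v >> + oper (opi_at B x << v >>))) => [||u].
- exact: lin_mapw.
- apply: lin_add; first exact: rota_baxter_linl.
  exact: lin_comp (opi_at_linl B_lin _) (lin_oper _).
- by rewrite mapwU phiE addrNK.
Qed.

Lemma phi_framer (u : bword Z) (x : kZ) :
  mapw (fun v => brack2 u v) x =
  opi_at phi << u >> x + oper (opi_at B << u >> x).
Proof.
move: x; apply: (lin_eq (g := fun x =>
  opi_at phi << u >> x + oper (opi_at B << u >> x))) => [||v].
- exact: lin_mapw.
- apply: lin_add; first exact: rota_baxter_linr.
  exact: lin_comp (opi_at_linr B_lin _) (lin_oper _).
- by rewrite mapwU phiE addrNK.
Qed.

Lemma bracks_not_atoms (u v : bword Z) :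
  all (predC (@is_atom Z)) (brack2 u v : seq _).
Proof. by rewrite fmM. Qed.

Lemma no_common_letters (d : seq (bletter Z)) :
  all (@is_atom Z) d -> all (predC (@is_atom Z)) d -> d = [::].
Proof. by case: d => // a d /= /andP[-> _]. Qed.

Lemma lead_iG s : iG s -> exists n, lead le s = word_incl n.
Proof. by case=> g _ <-; exists (lead le0 g); apply: lead_incl. Qed.

(** When the leading monomial of the relation is [1], it may also occur between
    or around the two brackets; any element with small monomials is then
    trivial. *)
Lemma degenerate_inclusion u v s c :
  iG s -> s != 0 -> lead le s = mone ->
  plug_ctx c (lead le s) = brack2 u v ->
  hspan H (below (brack2 u v))
    (opi_at phi << u >> << v >> - mapw (plug_ctx c) (monicize le s)).
Proof.
move=> iGs s0 s1 e; set h := _ - _.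
rewrite -[h]mapw_id; apply: (lin_bspan (lin_mapw _)) => m hm; rewrite mapwU.
apply: (lead1_trivial le_monomial (s := s)) => //; first by right.
have plug_inj : injective (plug_ctx c) := strict_mono_inj le_total (@plug_mono c).
split; last first.
  move=> em; case/eqP: hm; rewrite em mcoeffB phi_coeff -e mcoeff_mapw //.
  by rewrite mcoeff_monicize // subrr.
have [phim|phim] := eqVneq ((opi_at phi (<< u >> : kZ) << v >>)@_m) 0; last first.
  by rewrite -phi_lead; apply: lead_max.
move: hm; rewrite mcoeffB phim sub0r oppr_eq0 => /mapw_supp[n sn ->].
by rewrite -e; apply: (mono_le le_total (@plug_mono c)); apply: monicize_supp sn.
Qed.

(** A nonempty word of atoms in [ [u][v] ] lies inside one of the brackets, and
    the identity is linear in the corresponding variable. *)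
Lemma phi_inclusion u v s c :
  iG s -> s != 0 -> plug_ctx c (lead le s) = brack2 u v ->
  hspan H (below (brack2 u v))
    (opi_at phi << u >> << v >> - mapw (plug_ctx c) (monicize le s)).
Proof.
move=> iGs s0 e; have [s1|sn1] := eqVneq (lead le s) mone.
  exact: degenerate_inclusion.
have sa : all (@is_atom Z) (lead le s).
  by have [n ->] := lead_iG iGs; apply: word_incl_atoms.
have fill_e : fill c (lead le s) = [:: Brack u; Brack v].
  by move/(congr1 (fun w : bword Z => w : seq _)): e; rewrite fmM.
case: c e fill_e => [a b|a c b] e /= fill_e.
  have : all (predC (@is_atom Z)) (a ++ lead le s ++ b) by rewrite fill_e.
  rewrite !all_cat => /and3P[_ sna _].
  case/eqP: sn1; apply/eqP; rewrite fmP fm1.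
  exact/eqP/no_common_letters.
case: a e fill_e => [|x [|y a]] e [].
- move=> uE bE.
  have {}uE : plug_ctx c (lead le s) = u by apply/eqP; rewrite fmP /= uE.
  rewrite -e -uE.
  apply: (frame_composition le_monomial le_incl G_GS
    (Phi := fun r => opi_at phi r << v >>)
    (Beta := fun r => oper (opi_at B r << v >>))
    (frame := fun u => brack2 u v)) => [||x|u'|u'|u' m|x Kx|u'||].
  + exact: rota_baxter_linl.
  + exact: lin_comp (opi_at_linl B_lin _) (lin_oper _).
  + exact: phi_framel.
  + by exists u', v.
  + exact: phi_lead.
  + exact: oper_B_below.
  + exact: bspan_oper (opi_at_ideall B_lin (J := bspan_opideal le iG) _ Kx).
  + by rewrite /=; apply/eqP; rewrite fmP fmM /= bE.
  + exact: iGs.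
  + exact: s0.
- move=> xE vE bE.
  have {}vE : plug_ctx c (lead le s) = v by apply/eqP; rewrite fmP /= vE.
  rewrite -e -vE.
  apply: (frame_composition le_monomial le_incl G_GS
    (Phi := fun r => opi_at phi << u >> r)
    (Beta := fun r => oper (opi_at B << u >> r))
    (frame := fun v => brack2 u v)) => [||x'|v'|v'|v' m|x' Kx|v'||].
  + exact: rota_baxter_linr.
  + exact: lin_comp (opi_at_linr B_lin _) (lin_oper _).
  + exact: phi_framer.
  + by exists u, v'.
  + exact: phi_lead.
  + exact: oper_B_below.
  + exact: bspan_oper (opi_at_idealr B_lin (J := bspan_opideal le iG) _ Kx).
  + by rewrite /=; apply/eqP; rewrite fmP fmM /= xE bE.
  + exact: iGs.
  + exact: s0.
- by case: a {e}.
Qed.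

Lemma hspan_trivial_mod w h :
  hspan H (below w) h -> trivial_mod le (@star_subst Z) H w h.
Proof.
move=> Sh; apply/trivial_modP; apply: bspan_plug Sh => c.
by have [q qE] := ctx_star_word c; exists q => u; rewrite qE.
Qed.

(** This excludes intersections between the identity, whose leading monomials
    consist of brackets, and relations whose leading monomials consist of
    atoms. *)
Lemma no_overlap (T : Type) (p : pred T) (s t u v : seq T) :
  all p s -> all (predC p) t -> s ++ u = v ++ t -> (size v < size s)%N -> False.
Proof.
move=> ps pt e lt_vs; have [d [sE tE]] := catI_le (esym e) (ltnW lt_vs).
move: lt_vs ps pt; rewrite sE tE !all_cat size_cat => + /andP[_].
case: d {sE tE} => [|x d] /=; first by rewrite addn0 ltnn.
by move=> _ /andP[-> _].
Qed.

Lemma union_GS_basis : GS_basis le (@star_subst Z) H.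
Proof.
move=> f g Hf Hg f0 g0; split=> [u v w wf wg lt_w|q w wf wg]; last first.
  have [c qE] := star_word_ctx q.
  have wE : plug_ctx c (lead le g) = lead le f by rewrite -qE -wg.
  case: Hg => [Sg|iGg]; last first.
    apply: hspan_trivial_mod; rewrite plug_linE (eq_mapw qE) wf.
    case: Hf => [[u [v fE]]|iGf].
      rewrite fE phi_lead monicize_phi; apply: phi_inclusion => //.
      by rewrite wE fE phi_lead.
    have eqf : plug_ctx (Hole [::] [::]) (lead le f) = plug_ctx c (lead le g).
      by rewrite plug_ctx_id wE.
    have := incl_confluent le_monomial le_incl G_GS iGf iGg f0 g0 eqf.
    rewrite plug_ctx_id (eq_mapw (@plug_ctx_id Z)) mapw_id.
    by apply: bspan_sub.
  case: Hf => [Sf|iGf].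
    apply/trivial_modP; have /trivial_modP := (phi_GS Sf Sg f0 g0).2 q w wf wg.
    by apply: bspan_sub.
  have [n nE] := lead_iG iGf; move: wE; case: Sg => u [v ->].
  rewrite phi_lead nE => /(congr1 (fun w : bword Z => all (@is_atom Z) w)).
  rewrite word_incl_atoms.
  by case: c {qE} => [a b|a c b] /=; rewrite !fmM /= ?all_cat /= !andbF.
case: Hf Hg => [Sf|iGf] [Sg|iGg].
- apply/trivial_modP.
  have /trivial_modP := (phi_GS Sf Sg f0 g0).1 u v w wf wg lt_w.
  by apply: bspan_sub.
- have [n nE] := lead_iG iGg; case: Sf wf lt_w => u' [v' ->] wf lt_w.
  move: wf wg lt_w; rewrite phi_lead nE => -> e lt_w.
  have {}e := congr1 (fun w : bword Z => w : seq _) e.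
  move: e lt_w; rewrite 2!fmM => e /andP[_].
  rewrite e size_cat ltn_add2r => lt_v.
  exfalso; apply: (no_overlap (bracks_not_atoms u' v') _ e lt_v).
  by rewrite (eq_all (a2 := @is_atom Z)) ?word_incl_atoms // => x; rewrite /= negbK.
- have [n nE] := lead_iG iGf; case: Sg wg lt_w => u' [v' ->] wg lt_w.
  move: wf wg lt_w; rewrite phi_lead nE => -> e lt_w.
  have {}e := congr1 (fun w : bword Z => w : seq _) e.
  move: e lt_w; rewrite 2!fmM => e /andP[_].
  rewrite size_cat ltn_add2l => lt_u.
  exfalso; apply: (no_overlap (word_incl_atoms n) (bracks_not_atoms u' v') e).
  have := congr1 size e; rewrite !size_cat => se.
  by rewrite -(ltn_add2r (size (brack2 u' v'))) -se ltn_add2l.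
- apply: hspan_trivial_mod.
  have e : plug_ctx (Hole [::] u) (lead le f) = plug_ctx (Hole v [::]) (lead le g).
    have := etrans (esym wf) wg => /(congr1 (fun w : bword Z => w : seq _)).
    by rewrite !fmM /plug_ctx /= cats0 => ->.
  have -> : w = plug_ctx (Hole [::] u) (lead le f).
    by rewrite wf; apply/eqP; rewrite fmP fmM.
  rewrite mulr_plug mulU_plug.
  have := incl_confluent le_monomial le_incl G_GS iGf iGg f0 g0 e.
  by apply: bspan_sub.
Qed.

End Union.

(** * The free algebra over a presented algebra and its Groebner-Shirshov basis *)

Theorem theorem6p6 (k : fieldType) (Z : choiceType)
    (I : ideal {malg k[{fmonom Z}]}) (phi : opi k) :
  rota_baxter_type phi ->
  let J : opideal {malg k[bword Z]} :=
    gen_opideal (@S_opi k phi Z `|` [set malg_incl f | f in ideal_set I]) in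
  (exists2 i : quotient I -> op_quotient J,
     forall f, i (to_quotient I f) = to_op_quotient J (malg_incl f) &
     is_free_phi_algebra phi i) /\
  (forall (leZ : Z -> Z -> Prop) (ledb : bword Z -> bword Z -> Prop)
      (G : set {malg k[{fmonom Z}]}),
     well_order leZ ->
     monomial_order ledb ->
     (forall u v : {fmonom Z},
        ledb (word_incl u) (word_incl v) <-> dlex leZ u v) ->
     (forall u v : bword Z,
        lead ledb (opi_at phi (<< u >> : {malg k[bword Z]}) << v >>)
        = mmul (brack u) (brack v)) ->
     is_op_GS_basis_of ledb (@S_opi k phi Z) (gen_opideal (@S_opi k phi Z)) ->
     is_GS_basis_of (dlex leZ) G I ->
     is_op_GS_basis_of ledb (@S_opi k phi Z `|` [set malg_incl g | g in G]) J).
Proof.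
case=> B [-> B_lin _ _ _] J; split.
  apply: presented_free_phi_algebra; apply: quotient_phi_algebra => A r.
    exact: rota_baxter_linl.
  exact: rota_baxter_linr.
move=> leZ ledb G _ le_mon le_incl phi_lead [phi_GS _] [G_GS G_gen].
split; first exact (union_GS_basis le_mon le_incl G_GS B_lin phi_lead phi_GS).
have GI f : gen_ideal G f <-> I f.
  by rewrite -[gen_ideal G f]/(ideal_set (gen_ideal G) f) G_gen.
apply/seteqP; split; apply: gen_opideal_sub => f [Sf|[g Gg <-]].
- by apply: sub_gen_opideal; left.
- apply: sub_gen_opideal; right; exists g => //.
  by apply/GI => K; apply.
- by apply: sub_gen_opideal; left.
apply: (hom_gen_ideal (S := G) (malg_incl_hom k Z)); last exact/GI.
by move=> x Gx; apply: sub_gen_opideal; right; exists x.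
Qed.
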